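(* Let $\rho$ be a state such that for every $\epsilon>0$ there is $c$ with $QK^{\epsilon}(\rho_n)>n-c$ for all $n$. Then for every rational $s\in(0,1)$, $\rho$ passes every $s$-strong Solovay test.
   Context: Let $\mathbb{U}$ be a fixed universal prefix-free Turing machine. Finite sets of vectors with complex algebraic entries are coded by natural numbers via a fixed canonical effective indexing; $\mathbb{U}(\sigma)\downarrow=F$ means that $\mathbb{U}$ on input $\sigma$ halts and outputs the code of $F$. $\mathbb{C}^{2^n}_{alg}$ denotes the vectors in $\mathbb{C}^{2^n}$ with complex algebraic entries. Logarithms are base 2. For a density matrix $\tau$ on $\mathbb{C}^{2^{n}}$ write $|\tau|=n$, and for $\epsilon>0$ define $QK^{\epsilon}(\tau)=\inf\{|\sigma|+\log|F| : \mathbb{U}(\sigma)\downarrow=F,\ F \text{ an orthonormal subset of } \mathbb{C}^{2^{|\tau|}}_{alg},\ \sum_{v\in F}\langle v|\tau|v\rangle>\epsilon\}$, with $\inf\emptyset=\infty$. A state is a sequence $\rho=(\rho_n)_{n\in\mathbb{N}}$ of density matrices $\rho_n$ on $\mathbb{C}^{2^n}$ such that the partial trace of $\rho_n$ over the last qubit equals $\rho_{n-1}$. A special projection is a Hermitian projection matrix with complex algebraic entries. For a special projection $S$ on $\mathbb{C}^{2^n}$ put $\tau(S)=2^{-n}\operatorname{Tr}(S)$ and $\rho(S)=\operatorname{Tr}(\rho_nS)$. A strong Solovay test is a computable sequence $(S^m)_m$ of special projections with $\sum_m\tau(S^m)<\infty$; $\rho$ fails it at level $\epsilon>0$ if $\rho(S^m)>\epsilon$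 for infinitely many $m$, and passes it if it fails it at no level $\epsilon>0$. For rational $s\in(0,1)$, an $s$-strong Solovay test is a strong Solovay test $(S^r)_r$ such that $\sum_r\tau(S^r)^s<\infty$ and $\sum_r\tau(S^r)$ is a computable real number. *)

(* Defs.v *)
From HB Require Import structures.
From mathcomp Require Import all_boot all_order all_algebra.
From mathcomp Require Import complex.
From mathcomp Require Import all_classical all_reals all_analysis.
From mathcomp Require Import zify.

Set Implicit Arguments.
Unset Strict Implicit.
Unset Printing Implicit Defensive.

Import Order.TTheory GRing.Theory Num.Theory.
Import numFieldNormedType.Exports.
Local Open Scope ring_scope.

Inductive prf : Type :=
| PZero
| PSucc
| PProj (i : nat)
| PComp (f : prf) (gs : seq prf)
| PPrim (f g : prf)
| PMu (f : prf).

Fixpoint prf_eval (k : nat) (p : prf) (v : seq nat) {struct k} : option nat :=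
  match k with
  | 0 => None
  | k'.+1 =>
    match p with
    | PZero => Some 0%N
    | PSucc => Some (head 0%N v).+1
    | PProj i => Some (nth 0%N v i)
    | PComp f gs =>
        let fix evs (gs : seq prf) : option (seq nat) :=
          match gs with
          | [::] => Some [::]
          | g :: gs' =>
              match prf_eval k' g v, evs gs' with
              | Some y, Some ys => Some (y :: ys)
              | _, _ => None
              end
          end in
        match evs gs with Some ws => prf_eval k' f ws | None => None end
    | PPrim f g =>
        let fix rec (x : nat) : option nat :=
          match x with
          | 0 => prf_eval k' f (behead v)
          | x'.+1 =>
              match rec x' with
              | Some r => prf_eval k' g [:: x', r & behead v]
              | None => None
              end
          end in
        rec (head 0%N v)
    | PMu f =>
        let fix search (n fuel : nat) : option nat :=
          match fuel with
          | 0 => None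
          | fuel'.+1 =>
              match prf_eval k' f (n :: v) with
              | Some 0 => Some n
              | Some _ => search n.+1 fuel'
              | None => None
              end
          end in
        search 0%N k'
    end
  end.

Definition prf_conv (p : prf) (v : seq nat) (y : nat) : Prop :=
  exists k, prf_eval k p v = Some y.

Definition partial_computable (f : nat -> option nat) : Prop :=
  exists p : prf, forall x y, f x = Some y <-> prf_conv p [:: x] y.

Definition total_computable (f : nat -> nat) : Prop :=
  exists p : prf, forall x, prf_conv p [:: x] (f x).

(** Bijective coding of binary strings by natural numbers. *)
Fixpoint str_code (s : seq bool) : nat :=
  match s with
  | [::] => 0%N
  | b :: s' => ((str_code s').*2 + b).+1
  end.

Definition machine := seq bool -> option nat.

Definition machine_computable (M : machine) : Prop :=
  exists p : prf, forall s y, M s = Some y <-> prf_conv p [:: str_code s] y.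

Definition prefix_free (M : machine) : Prop :=
  forall s t, M s <> None -> M (s ++ t) <> None -> t = [::].

Definition pf_machine (M : machine) : Prop :=
  machine_computable M /\ prefix_free M.

Definition universal_pf (U : machine) : Prop :=
  pf_machine U /\
  forall M, pf_machine M -> exists tau : seq bool, forall sigma, U (tau ++ sigma) = M sigma.

Section Complex.
Variable R : realType.
Local Notation C := R[i].

Definition algebraic (z : C) : Prop :=
  exists p : {poly rat}, p != 0 /\ root (map_poly (ratr : rat -> C) p) z.

(** Code of an algebraic number: an integer polynomial (coefficient list,
    low degree first) and a rational box [a,b] x [c,d] isolating one root. *)
Definition entry_code := (seq int * (rat * rat * rat * rat))%type.
Definition entry0 : entry_code := ([::], (0, 0, 0, 0)).

Definition in_box (e : entry_code) (w : C) : bool :=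
  let: (a, b, c, d) := e.2 in
  (ratr a <= complex.Re w <= ratr b) && (ratr c <= complex.Im w <= ratr d).

Definition entry_poly (e : entry_code) : {poly C} :=
  map_poly (fun a : int => a%:~R) (Poly e.1).

Definition entry_denotes (e : entry_code) (z : C) : Prop :=
  entry_poly e != 0 /\ root (entry_poly e) z /\ in_box e z /\
  forall w, root (entry_poly e) w -> in_box e w -> w = z.

Definition vec_denotes (ev : seq entry_code) (v : seq C) : Prop :=
  size ev = size v /\
  forall i, (i < size v)%N -> entry_denotes (nth entry0 ev i) (nth 0 v i).

(** The natural number [c] codes the finite set of vectors given by the list
    [L] (the set being [undup L]); codes are decoded with the canonical
    effective indexing [unpickle] of MathComp countable types. *)
Definition codes_set (c : nat) (L : seq (seq C)) : Prop :=
  exists d : seq (seq entry_code),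
    unpickle c = Some d /\ size d = size L /\
    forall i, (i < size L)%N -> vec_denotes (nth [::] d i) (nth [::] L i).

Definition mx_denotes (n : nat) (d : seq (seq entry_code)) (A : 'M[C]_(2 ^ n)) : Prop :=
  size d = (2 ^ n)%N /\
  forall i j : 'I_(2 ^ n),
    size (nth [::] d i) = (2 ^ n)%N /\
    entry_denotes (nth entry0 (nth [::] d i) j) (A i j).

Definition inner (u w : seq C) : C :=
  \sum_(i < size u) conjc (nth 0 u i) * nth 0 w i.

Definition orthonormal (F : seq (seq C)) : Prop :=
  forall i j, (i < size F)%N -> (j < size F)%N ->
    inner (nth [::] F i) (nth [::] F j) = (i == j)%:R.

Definition braket (n : nat) (v : seq C) (A : 'M[C]_(2 ^ n)) : C :=
  \sum_(i < 2 ^ n) \sum_(j < 2 ^ n) conjc (nth 0 v i) * A i j * nth 0 v j.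

Definition hermitian (m : nat) (A : 'M[C]_m) : Prop :=
  forall i j, A j i = conjc (A i j).

Definition psd (m : nat) (A : 'M[C]_m) : Prop :=
  forall v : 'cV[C]_m,
    0 <= \sum_(i < m) \sum_(j < m) conjc (v i 0) * A i j * v j 0.

Definition density_matrix (m : nat) (A : 'M[C]_m) : Prop :=
  hermitian A /\ psd A /\ \tr A = 1.

Lemma qidx_lt (n : nat) (i : 'I_(2 ^ n)) (b : 'I_2) : (2 * i + b < 2 ^ n.+1)%N.
Proof.
rewrite expnS; have hi := ltn_ord i; have hb := ltn_ord b.
move: hi hb; set z := (2 ^ n)%N; move: (nat_of_ord i) (nat_of_ord b) => x y; lia.
Qed.

(** Index of C^(2^(n+1)) = C^(2^n) (x) C^2: first n qubits [i], last qubit [b]. *)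
Definition qidx (n : nat) (i : 'I_(2 ^ n)) (b : 'I_2) : 'I_(2 ^ n.+1) :=
  Ordinal (qidx_lt i b).

Definition ptrace_last (n : nat) (A : 'M[C]_(2 ^ n.+1)) : 'M[C]_(2 ^ n) :=
  \matrix_(i, j) \sum_(b < 2) A (qidx i b) (qidx j b).

Definition is_state (rho : forall n, 'M[C]_(2 ^ n)) : Prop :=
  (forall n, density_matrix (rho n)) /\
  (forall n, ptrace_last (rho n.+1) = rho n).

Definition log2 (x : R) : R := ln x / ln 2.

Definition QK (U : machine) (eps : R) (n : nat) (tau : 'M[C]_(2 ^ n)) : \bar R :=
  ereal_inf [set x : \bar R | exists (sigma : seq bool) (c : nat) (L : seq (seq C)),
    U sigma = Some c /\ codes_set c L /\
    let F := undup L in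
    (forall v, v \in F -> size v = (2 ^ n)%N) /\
    orthonormal F /\
    Complex eps 0 < \sum_(v <- F) braket v tau /\
    x = ((size sigma)%:R + log2 (size F)%:R)%:E].

Definition special_projection (n : nat) (S : 'M[C]_(2 ^ n)) : Prop :=
  hermitian S /\ S *m S = S /\ forall i j, algebraic (S i j).

(** tau(S) = 2^-n Tr(S) (a real number, taken as a real). *)
Definition tauS (n : nat) (S : 'M[C]_(2 ^ n)) : R := complex.Re (\tr S) / (2 ^ n)%:R.

Definition rhoS (rho : forall n, 'M[C]_(2 ^ n)) (n : nat) (S : 'M[C]_(2 ^ n)) : C :=
  \tr (rho n *m S).

Definition computable_proj_seq (dim : nat -> nat) (S : forall m, 'M[C]_(2 ^ dim m)) : Prop :=
  exists g : nat -> nat, total_computable g /\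
    forall m, exists d : seq (seq entry_code),
      unpickle (g m) = Some (dim m, d) /\ mx_denotes d (S m).

Definition computable_real (x : R) : Prop :=
  exists f : nat -> nat, total_computable f /\
    forall k, exists q : rat, unpickle (f k) = Some q /\
      `|x - ratr q| <= (2 ^+ k)^-1.

Definition strong_solovay_test (dim : nat -> nat) (S : forall m, 'M[C]_(2 ^ dim m)) : Prop :=
  computable_proj_seq S /\
  (forall m, special_projection (S m)) /\
  cvgn (series (fun m => tauS (S m))).

Definition s_strong_solovay_test (s : rat) (dim : nat -> nat)
    (S : forall m, 'M[C]_(2 ^ dim m)) : Prop :=
  strong_solovay_test S /\
  cvgn (series (fun m => tauS (S m) `^ ratr s)) /\
  computable_real (limn (series (fun m => tauS (S m)))).

Definition fails_at (rho : forall n, 'M[C]_(2 ^ n)) (dim : nat -> nat)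
    (S : forall m, 'M[C]_(2 ^ dim m)) (eps : R) : Prop :=
  forall M : nat, exists m, (M <= m)%N /\ Complex eps 0 < rhoS rho (S m).

Definition passes (rho : forall n, 'M[C]_(2 ^ n)) (dim : nat -> nat)
    (S : forall m, 'M[C]_(2 ^ dim m)) : Prop :=
  forall eps : R, 0 < eps -> ~ fails_at rho S eps.

End Complex.

(* Main.v *)
(** The strings [1^q 0 x] with [|x| = a q + b] form a prefix-free set, so a machine
may describe the [t]-th index [m] of level [q], where [q] is about
[- log tau(S^m) / (a + 2)], by [(a + 1) q + b + 1] bits.  Summability of
[tau(S^m)^s] bounds the number of indices of level [q] by [2^(a q + b)] as soon
as [s (a + 2) <= a], so every index gets a description, and
[QK^eps(rho_n) <= n - q + O(1)] whenever [rho(S^m)] is large.  As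
[tau(S^m) -> 0], [q] is unbounded, which contradicts the hypothesis.

The machine does not output a basis of the range of [S^m]: it searches for
pairwise orthogonal vectors with Gaussian integer coordinates whose span is close
to that range.  Such vectors exist by Gram-Schmidt orthogonalization of rational
approximations, their normalizations have explicit codes, and closeness to [S^m]
is certified by integer arithmetic on a grid in the isolating box of each entry. *)

Require Import Defs.
From HB Require Import structures.
From mathcomp Require Import all_boot all_order all_algebra.
From mathcomp Require Import complex.
From mathcomp Require Import all_classical all_reals all_analysis.
From mathcomp Require Import zify ring lra.
Import Order.TTheory GRing.Theory Num.Theory.
Import numFieldNormedType.Exports.
Local Open Scope ring_scope.

Set Implicit Arguments.
Unset Strict Implicit.
Unset Printing Implicit Defensive.

(** * Evaluation of partial recursive functions *)

(** Using the range of [S^m] itself would call for exact linear algebra over codes of algebraic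
    numbers. Over the Gaussian integers orthogonality and all estimates are statements about
    integers, and normalizing a vector brings in a single square root, whose code is explicit. The
    certificate has a gap: an entry that it accepts is within [1 / T] of its target, and an entry
    closer than [1 / (4 T)] is accepted on every fine enough grid. An unbounded search therefore
    stops without deciding any equality of algebraic numbers. The level is defined from the number
    [r] of vectors found, not from [tau(S^m)], so that membership compares integers. Precision
    [2^-(2 n + k)] per entry keeps [r] within [1 / 2] of the trace, hence [r <= 2 Tr(S^m)] once
    [r > 0], and costs at most [eps / 2] of the weight. Since [r <= 2^(n - (a + 2) q)], a
    description of [(a + 1) q + b + 1] bits leaves [n - q + b + 1]: the exponent [a + 2] is chosen
    to make the coefficient of [q] equal to [-1], and [s < 1] makes [s (a + 2) <= a] solvable. *)

(* The parameters stay outside the [fix] so that these functions are convertible to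
   the local fixpoints of [prf_eval]. *)
Definition prf_evals k v := fix evs (gs : seq prf) : option (seq nat) :=
  match gs with
  | [::] => Some [::]
  | g :: gs' =>
      match prf_eval k g v, evs gs' with
      | Some y, Some ys => Some (y :: ys)
      | _, _ => None
      end
  end.

Definition prf_rec k f g w := fix rec (x : nat) : option nat :=
  match x with
  | 0 => prf_eval k f w
  | x'.+1 =>
      match rec x' with
      | Some r => prf_eval k g [:: x', r & w]
      | None => None
      end
  end.

Definition prf_search k f v := fix search (n fuel : nat) : option nat :=
  match fuel with
  | 0 => None
  | fuel'.+1 =>
      match prf_eval k f (n :: v) with
      | Some 0 => Some n
      | Some _ => search n.+1 fuel'
      | None => None
      end
  end.

Lemma prf_evalE_comp k f gs v : prf_eval k.+1 (PComp f gs) v =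
  if prf_evals k v gs is Some ws then prf_eval k f ws else None.
Proof. by []. Qed.

Lemma prf_evalE_prim k f g v :
  prf_eval k.+1 (PPrim f g) v = prf_rec k f g (behead v) (head 0%N v).
Proof. by []. Qed.

Lemma prf_evalE_mu k f v : prf_eval k.+1 (PMu f) v = prf_search k f v 0 k.
Proof. by []. Qed.

(** The fuel bounds both the nesting depth and the number of values tried by [PMu], and more of
    either cannot change a result already reached. Computations run with different fuels can thus be
    merged at the maximum. *)
Lemma prf_eval_mono k k' p v y :
  (k <= k')%N -> prf_eval k p v = Some y -> prf_eval k' p v = Some y.
Proof.
elim: k k' p v y => [//|k IH] [//|k'] p v y lek; have {}lek : (k <= k')%N by [].
case: p => [|||f gs|f g|f] //.
- rewrite !prf_evalE_comp; case HE : prf_evals => [ws|//] H.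
  have -> : prf_evals k' v gs = Some ws.
    elim: gs ws HE {H} => [|g gs IHgs] //= ws.
    case Eg: (prf_eval k g v) => [z|//]; rewrite (IH _ _ _ _ lek Eg).
    by case HE : prf_evals => [zs|//] [<-]; rewrite (IHgs zs).
  exact: IH H.
- rewrite !prf_evalE_prim; elim: (head 0%N v) y => [|x IHx] y /=; first exact: IH.
  by case HE : prf_rec => [z|//] H; rewrite (IHx z) //; apply: IH H.
- rewrite !prf_evalE_mu.
  suff H n j j' : (j <= j')%N -> prf_search k f v n j = Some y -> prf_search k' f v n j' = Some y.
    exact: H.
  elim: j j' n => [//|j IHj] [//|j'] n /= lej.
  case HE : prf_eval => [z|//]; rewrite (IH _ _ _ _ lek HE).
  by case: z {HE} => // z; apply: IHj.
Qed.

Lemma prf_evals_mono k k' v gs ws :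
  (k <= k')%N -> prf_evals k v gs = Some ws -> prf_evals k' v gs = Some ws.
Proof.
move=> lek; elim: gs ws => [//|h gs IH] ws; rewrite /= -/(prf_evals k v) -/(prf_evals k' v).
case Eg: (prf_eval k h v) => [z|//]; rewrite (prf_eval_mono lek Eg).
by case E: prf_evals => [zs|//] [<-]; rewrite (IH _ E).
Qed.

Lemma prf_rec_mono k k' f g w x y :
  (k <= k')%N -> prf_rec k f g w x = Some y -> prf_rec k' f g w x = Some y.
Proof.
move=> lek; elim: x y => [|n IH] y; first exact: prf_eval_mono.
rewrite /= -/(prf_rec k f g w) -/(prf_rec k' f g w).
by case E: prf_rec => [u|//]; rewrite (IH _ E); apply: prf_eval_mono.
Qed.

Lemma prf_conv_fun p v y y' : prf_conv p v y -> prf_conv p v y' -> y = y'.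
Proof.
move=> [k Hk] [k' Hk'].
have := prf_eval_mono (leq_maxl k k') Hk.
by rewrite (prf_eval_mono (leq_maxr k k') Hk') => -[].
Qed.

(** Evaluation knows no arities, so a [k]-ary function is a function of lists of which only the
    values at lists of length [k] count. *)
Definition recf k (f : seq nat -> nat) :=
  exists p, forall v, size v = k -> prf_conv p v (f v).

Lemma eq_recf k f g : (forall v, size v = k -> f v = g v) -> recf k f -> recf k g.
Proof. by move=> e [p hp]; exists p => v hv; rewrite -e //; apply: hp. Qed.

Lemma prf_conv_comp p v y gs ws : size gs = size ws ->
  (forall i, (i < size gs)%N -> prf_conv (nth PZero gs i) v (nth 0%N ws i)) ->
  prf_conv p ws y -> prf_conv (PComp p gs) v y.
Proof.
move=> sz hgs [kp hp].
have [k hk] : exists k, prf_evals k v gs = Some ws.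
  elim: gs ws sz hgs {hp} => [|g gs IH] [|w ws] // sz hgs.
    by exists 0%N.
  move: sz => [sz].
  have [k hk] := IH ws sz (fun i hi => hgs i.+1 hi).
  have [k' hk'] := hgs 0%N isT.
  rewrite /= in hk'; exists (maxn k k') => /=; rewrite (prf_eval_mono (leq_maxr _ _) hk').
  by rewrite -/(prf_evals _ v) (prf_evals_mono (leq_maxl _ _) hk).
exists (maxn k kp).+1; rewrite prf_evalE_comp.
rewrite (prf_evals_mono (leq_maxl _ _) hk).
exact: prf_eval_mono (leq_maxr _ _) hp.
Qed.

Lemma prf_conv_prim p q w z h n :
  prf_conv p w z -> (forall i r, prf_conv q [:: i, r & w] (h i r)) ->
  prf_conv (PPrim p q) (n :: w) (iteri n h z).
Proof.
move=> hp hq.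
have [k hk] : exists k, prf_rec k p q w n = Some (iteri n h z).
  elim: n => [|n [k hk]] /=; first by have [k hk] := hp; exists k.
  have [k' hk'] := hq n (iteri n h z).
  exists (maxn k k'); rewrite (prf_rec_mono (leq_maxl _ _) hk).
  exact: prf_eval_mono (leq_maxr _ _) hk'.
by exists k.+1; rewrite prf_evalE_prim.
Qed.

Lemma prf_conv_mu p v f n : (forall i, prf_conv p (i :: v) (f i)) ->
  f n = 0%N -> (forall i, (i < n)%N -> f i <> 0%N) -> prf_conv (PMu p) v n.
Proof.
move=> hp fn0 fi.
have [k hk] : exists k, forall i, (i <= n)%N -> prf_eval k p (i :: v) = Some (f i).
  elim: n {fn0 fi} => [|n [k hk]].
    by have [k hk] := hp 0%N; exists k => -[].
  have [k' hk'] := hp n.+1; exists (maxn k k') => i; rewrite leq_eqVlt => /orP[/eqP->|].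
    exact: prf_eval_mono (leq_maxr _ _) hk'.
  by move=> lin; apply: prf_eval_mono (leq_maxl _ _) (hk i lin).
(* Fuel [k] makes every evaluation up to [n] terminate; [n.+1] rounds let the search reach [n]. *)
exists (maxn k n.+1).+1; rewrite prf_evalE_mu.
have hk' i : (i <= n)%N -> prf_eval (maxn k n.+1) p (i :: v) = Some (f i).
  by move=> /hk; apply/prf_eval_mono/leq_maxl.
suff H j fuel : (j <= n)%N -> (n < j + fuel)%N ->
    prf_search (maxn k n.+1) p v j fuel = Some n by apply: H; rewrite ?leq_maxr.
elim: fuel j => [|fuel IH] j lejn hj /=; first by lia.
rewrite hk' //; have [e|/eqP ne] := eqVneq j n; first by rewrite e fn0.
have := fi j ltac:(lia); case: (f j) => // z _; apply: IH; lia.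
Qed.

(** Serves to read off, from the mere halting of a search, that its result passes the test. *)
Lemma prf_mu_conv p v f n : (forall i, prf_conv p (i :: v) (f i)) ->
  prf_conv (PMu p) v n -> f n = 0%N /\ (forall i, (i < n)%N -> f i <> 0%N).
Proof.
move=> hp [[//|k]]; rewrite prf_evalE_mu => hk.
suff H j fuel : (forall i, (i < j)%N -> f i <> 0%N) ->
    prf_search k p v j fuel = Some n -> f n = 0%N /\ (forall i, (i < n)%N -> f i <> 0%N).
  by apply: (H _ _ _ hk).
elim: fuel j {hk} => [//|fuel IH] j hj /=.
case E: prf_eval => [z|//]; have fz : f j = z.
  by apply: (prf_conv_fun (hp j)); exists k.
case: z E fz => [|z] E fz; first by move=> [<-].
apply: IH => i; rewrite ltnS leq_eqVlt => /orP[/eqP->|]; [by rewrite fz|exact: hj].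
Qed.

Lemma recf_nth k i : recf k (fun v => nth 0%N v i).
Proof. by exists (PProj i) => v _; exists 1%N. Qed.

Lemma recf_comp k f gs : recf (size gs) f -> (forall i, (i < size gs)%N -> recf k (nth (fun=> 0%N) gs i)) ->
  recf k (fun v => f [seq g v | g <- gs]).
Proof.
move=> [p hp] hgs.
have [ps [sz hps]] : exists ps, size ps = size gs /\ forall i v, (i < size gs)%N -> size v = k ->
    prf_conv (nth PZero ps i) v (nth (fun=> 0%N) gs i v).
  elim: gs hgs {hp} => [|g gs IH] hgs; first by exists [::].
  have [ps [sz hps]] := IH (fun i hi => hgs i.+1 hi).
  have [q hq] := hgs 0%N isT.
  by exists (q :: ps); split=> [/=|[|i] v hi hv]; rewrite ?sz //; [apply: hq|apply: hps].
exists (PComp p ps) => v hv; apply: prf_conv_comp (hp _ _); rewrite ?size_map //.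
by move=> i hi; rewrite sz in hi; rewrite (nth_map (fun=> 0%N)) //; apply: hps.
Qed.

Definition recf1 (F : nat -> nat) := recf 1 (fun v => F (nth 0%N v 0)).
Definition recf2 (F : nat -> nat -> nat) := recf 2 (fun v => F (nth 0%N v 0) (nth 0%N v 1)).

Lemma recf_ap1 k F f : recf1 F -> recf k f -> recf k (fun v => F (f v)).
Proof.
by move=> hF hf; apply: (@recf_comp k (fun w => F (nth 0%N w 0)) [:: f]) => // -[].
Qed.

Lemma recf_ap2 k F f g : recf2 F -> recf k f -> recf k g -> recf k (fun v => F (f v) (g v)).
Proof.
by move=> hF hf hg; apply: (@recf_comp k (fun w => F (nth 0%N w 0) (nth 0%N w 1)) [:: f; g]) => // -[|[]].
Qed.

Lemma recf_S k f : recf k f -> recf k (fun v => (f v).+1).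
Proof.
apply: (recf_ap1 (F := succn)); exists PSucc => -[//|a v] _; by exists 1%N.
Qed.

Lemma recf_const k c : recf k (fun=> c).
Proof.
by elim: c => [|c IH]; [exists PZero => v _; exists 1%N|apply: recf_S].
Qed.

Lemma recf_iteri k n z (h : nat -> nat -> seq nat -> nat) : recf k n -> recf k z ->
  recf k.+2 (fun w => h (nth 0%N w 0) (nth 0%N w 1) (drop 2 w)) ->
  recf k (fun v => iteri (n v) (fun i r => h i r v) (z v)).
Proof.
move=> hn [pz hz] [ph hh].
(* [PPrim] recurses on the first entry of its vector, so the number of rounds is first made an extra
   argument. *)
have H : recf k.+1 (fun w => iteri (nth 0%N w 0) (fun i r => h i r (behead w)) (z (behead w))).
  exists (PPrim pz ph) => -[//|a v] [hv]; apply: prf_conv_prim; first exact: hz.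
  move=> i r; have := hh [:: i, r & v]; rewrite /= drop0; apply; by rewrite /= hv.
(* Rebuilding [v] from its projections turns the substitution of [n v] for the extra argument into a
   composition. *)
apply: (@eq_recf _ (fun v => iteri (n v) (fun i r => h i r (mkseq (nth 0%N v) k)) (z (mkseq (nth 0%N v) k)))).
  by move=> v hv; rewrite -{1 2}hv mkseq_nth.
have := @recf_comp k _ (n :: mkseq (fun i v => nth 0%N v i) k); rewrite /= size_mkseq => /(_ _ H) H2.
apply: eq_recf (H2 _) => [v hv|[|i] hi] /=; rewrite -?map_comp //.
by rewrite nth_mkseq //; apply: recf_nth.
Qed.

Lemma recf_mu k (f : nat -> seq nat -> nat) (m : seq nat -> nat) :
  recf k.+1 (fun w => f (nth 0%N w 0) (behead w)) ->
  (forall v, size v = k -> f (m v) v = 0%N /\ forall i, (i < m v)%N -> f i v <> 0%N) -> recf k m.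
Proof.
move=> [p hp] hm; exists (PMu p) => v hv; have [h1 h2] := hm v hv.
by apply: (prf_conv_mu (f := f^~ v)) => // i; apply: (hp (i :: v)); rewrite /= hv.
Qed.

Lemma recf2_add : recf2 addn.
Proof.
apply: (@eq_recf _ (fun v => iteri (nth 0%N v 0) (fun i r => r.+1) (nth 0%N v 1))) => [v _|].
  by elim: (nth 0%N v 0) => //= n ->.
apply: (@recf_iteri 2 _ _ (fun i r v => r.+1)); do ?apply: recf_nth.
by apply: recf_S; apply: recf_nth.
Qed.

Lemma recf1_pred : recf1 predn.
Proof.
apply: (@eq_recf _ (fun v => iteri (nth 0%N v 0) (fun i r => i) 0%N)) => [v _|].
  by case: (nth 0%N v 0).
by apply: (@recf_iteri 1 _ _ (fun i r v => i)); do ?apply: recf_const; apply: recf_nth.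
Qed.

Lemma recf2_sub : recf2 subn.
Proof.
apply: (@eq_recf _ (fun v => iteri (nth 0%N v 1) (fun i r => r.-1) (nth 0%N v 0))) => [v _|].
  by elim: (nth 0%N v 1) => [|n /= ->]; rewrite ?subn0 // subnS.
apply: (@recf_iteri 2 _ _ (fun i r v => r.-1)); do ?apply: recf_nth.
by apply: (recf_ap1 recf1_pred); apply: recf_nth.
Qed.

Lemma recf2_mul : recf2 muln.
Proof.
apply: (@eq_recf _ (fun v => iteri (nth 0%N v 0) (fun i r => nth 0 v 1 + r)%N 0%N)) => [v _|].
  by elim: (nth 0%N v 0) => [|n /= ->]; rewrite ?mul0n // mulSn.
apply: (@recf_iteri 2 _ _ (fun i r v => nth 0 v 1 + r)%N); [exact: recf_nth|exact: recf_const|].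
apply: (recf_ap2 recf2_add); last exact: recf_nth.
by apply: eq_recf (recf_nth _ 3) => v _; rewrite nth_drop.
Qed.

Lemma recf2_exp : recf2 expn.
Proof.
apply: (@eq_recf _ (fun v => iteri (nth 0%N v 1) (fun i r => nth 0 v 0 * r)%N 1%N)) => [v _|].
  by elim: (nth 0%N v 1) => [|n /= ->]; rewrite ?expn0 // expnS.
apply: (@recf_iteri 2 _ _ (fun i r v => nth 0 v 0 * r)%N); [exact: recf_nth|exact: recf_const|].
apply: (recf_ap2 recf2_mul); last exact: recf_nth.
by apply: eq_recf (recf_nth _ 2) => v _; rewrite nth_drop.
Qed.

(** Primitive recursion on [(i.+1)./2 = i - i./2]. *)
Lemma recf1_half : recf1 half.
Proof.
apply: (@eq_recf _ (fun v => iteri (nth 0%N v 0) (fun i r => i - r)%N 0%N)) => [v _|].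
  elim: (nth 0%N v 0) => [//|n /= ->]; rewrite uphalfE. lia.
apply: (@recf_iteri 1 _ _ (fun i r v => i - r)%N); [exact: recf_nth|exact: recf_const|].
by apply: (recf_ap2 recf2_sub); apply: recf_nth.
Qed.

Lemma recf1_odd : recf1 (fun n => odd n : nat).
Proof.
apply: (@eq_recf _ (fun v => iteri (nth 0%N v 0) (fun i r => 1 - r)%N 0%N)) => [v _|].
  by elim: (nth 0%N v 0) => [//|n /= ->]; case: odd.
apply: (@recf_iteri 1 _ _ (fun i r v => 1 - r)%N); [exact: recf_nth|exact: recf_const|].
by apply: (recf_ap2 recf2_sub); [apply: recf_const|apply: recf_nth].
Qed.

(** * List operations on codes of lists of numbers *)

Definition code_head c := head 0%N (CodeSeq.decode c).
Definition code_tail c := CodeSeq.code (behead (CodeSeq.decode c)).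
(** The formula of [CodeSeq.code] for a nonempty list: the head is the exponent of 2 in the code,
    and the odd part gives the tail. *)
Definition code_cons x c := (2 ^ x * c.*2.+1)%N.

Lemma recf2_cons : recf2 code_cons.
Proof.
apply: (recf_ap2 recf2_mul).
  by apply: (recf_ap2 recf2_exp); [apply: recf_const|apply: recf_nth].
apply: recf_S; apply: (@eq_recf _ (fun v => nth 0%N v 1 + nth 0%N v 1)%N).
  by move=> v _; rewrite addnn.
by apply: (recf_ap2 recf2_add); apply: recf_nth.
Qed.

Lemma recf_iter_half k f g : recf k f -> recf k g -> recf k (fun v => iter (f v) half (g v)).
Proof.
move=> hf hg; apply: (@eq_recf _ (fun v => iteri (f v) (fun i r => r./2) (g v))) => //.
apply: (@recf_iteri k _ _ (fun i r v => r./2)) => //.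
by apply: (recf_ap1 recf1_half); apply: recf_nth.
Qed.

Lemma iter_half_code x s i : (i <= x)%N ->
  iter i half (CodeSeq.code (x :: s)) = (2 ^ (x - i) * (CodeSeq.code s).*2.+1)%N.
Proof.
elim: i => [|i IH] hi; first by rewrite subn0.
rewrite iterS IH; last exact: ltnW.
have -> : (x - i = (x - i.+1).+1)%N by lia.
by rewrite expnS -mulnA mul2n doubleK.
Qed.

Lemma code_tailE c : code_tail c = (iter (code_head c) half c)./2.
Proof.
rewrite /code_tail /code_head -{3}[c]CodeSeq.decodeK.
case: (CodeSeq.decode c) => // x s; rewrite [head _ _]/= [behead _]/=.
by rewrite iter_half_code // subnn mul1n /= uphalf_double.
Qed.

Lemma recf1_head : recf1 code_head.
Proof.
(* The search looks for the exponent of 2. The factor [nth 0 v 0] stops it at once on the code 0 of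
   the empty list, which has no odd quotient. *)
apply: (@recf_mu 1 (fun i v => nth 0 v 0 * (1 - odd (iter i half (nth 0 v 0))))%N).
  apply: (recf_ap2 recf2_mul).
    by apply: eq_recf (recf_nth _ 1) => v _; rewrite nth_behead.
  apply: (recf_ap2 recf2_sub); first exact: recf_const.
  apply: (recf_ap1 recf1_odd); apply: recf_iter_half; first exact: recf_nth.
  by apply: eq_recf (recf_nth _ 1) => v _; rewrite nth_behead.
move=> v _; move: (nth _ _ _) => c; rewrite /code_head -[c]CodeSeq.decodeK CodeSeq.codeK.
case: (CodeSeq.decode c) => [//|x s]; rewrite [head _ _]/=; split=> [|i hi].
  by rewrite iter_half_code // subnn mul1n /= odd_double muln0.
rewrite iter_half_code; last exact: ltnW.
have -> : (x - i = (x - i.+1).+1)%N by lia.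
rewrite expnS -mulnA mul2n odd_double muln1 /=; apply/eqP.
by rewrite muln_eq0 expn_eq0.
Qed.

Lemma recf1_tail : recf1 code_tail.
Proof.
apply: (@eq_recf _ (fun v => (iter (code_head (nth 0 v 0)) half (nth 0 v 0))./2)%N).
  by move=> v _; rewrite code_tailE.
apply: (recf_ap1 recf1_half); apply: recf_iter_half; last exact: recf_nth.
exact: recf1_head.
Qed.

(** * Computable functions between countable types *)

Lemma recf_if k (b : seq nat -> bool) f g : recf k (fun v => b v : nat) -> recf k f -> recf k g ->
  recf k (fun v => if b v then f v else g v).
Proof.
move=> hb hf hg; apply: (@eq_recf _ (fun v => b v * f v + (1 - b v) * g v)%N).
  by move=> v _; case: (b v); rewrite ?mul1n ?mul0n ?addn0.
apply: (recf_ap2 recf2_add); apply: (recf_ap2 recf2_mul) => //.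
by apply: (recf_ap2 recf2_sub) => //; apply: recf_const.
Qed.

(** [F] is arbitrary on numbers that code no element of [A], so composing functions never requires
    recognizing codes. *)
Definition computable (A B : countType) (f : A -> B) :=
  exists2 F : nat -> nat, recf1 F & forall a, F (pickle a) = pickle (f a).

(** Many types share their codes: a boolean is coded as a number, an option as a list, an integer as
    a pair of options. Computability passes between such types through this lemma. *)
Lemma comp_code (A B C : countType) (f : A -> B) (g : A -> C) :
  computable g -> (forall a, pickle (f a) = pickle (g a)) -> computable f.
Proof. by move=> [G hG eG] e; exists G => // a; rewrite eG e. Qed.

Lemma eq_computable (A B : countType) f (f' : A -> B) : (forall a, f a = f' a) -> computable f -> computable f'.
Proof. by move=> e hf; apply: (comp_code hf) => a; rewrite e. Qed.

Lemma comp_id (A : countType) : computable (fun a : A => a).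
Proof. by exists id => //; apply: recf_nth. Qed.

Lemma comp_const (A B : countType) (c : B) : computable (fun _ : A => c).
Proof. by exists (fun=> pickle c) => [|//]; apply: (recf_const 1 (pickle c)). Qed.

Lemma comp_ap (A B C : countType) (h : B -> C) (f : A -> B) :
  computable h -> computable f -> computable (fun a => h (f a)).
Proof.
move=> [H hH eH] [F hF eF]; exists (fun x => H (F x)); first exact: (recf_ap1 hH hF).
by move=> a; rewrite eF eH.
Qed.

Lemma recf1_pair F G : recf1 F -> recf1 G -> recf1 (fun x => CodeSeq.code [:: F x; G x]).
Proof.
move=> hF hG; apply: (recf_ap2 recf2_cons) => //; apply: (recf_ap2 recf2_cons) => //.
exact: recf_const.
Qed.

Lemma comp_pair (A B C : countType) (f : A -> B) (g : A -> C) :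
  computable f -> computable g -> computable (fun a => (f a, g a)).
Proof.
move=> [F hF eF] [G hG eG].
by exists (fun x => CodeSeq.code [:: F x; G x]); [apply: recf1_pair|move=> a; rewrite eF eG].
Qed.

Lemma comp_fst (A B C : countType) (f : A -> B * C) : computable f -> computable (fun a => (f a).1).
Proof.
move=> [F hF eF]; exists (fun x => code_head (F x)); first exact: (recf_ap1 recf1_head).
by move=> a; rewrite eF /code_head; case: (f a) => b c; rewrite CodeSeq.codeK.
Qed.

Lemma comp_snd (A B C : countType) (f : A -> B * C) : computable f -> computable (fun a => (f a).2).
Proof.
move=> [F hF eF]; exists (fun x => code_head (code_tail (F x))).
  by apply: (recf_ap1 recf1_head); apply: (recf_ap1 recf1_tail).
move=> a; rewrite eF /code_head /code_tail; case: (f a) => b c.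
by rewrite !CodeSeq.codeK.
Qed.

Lemma comp_if (A B : countType) (b : A -> bool) f (f' : A -> B) : computable b -> computable f -> computable f' ->
  computable (fun a => if b a then f a else f' a).
Proof.
move=> [G hG eG] [F hF eF] [F' hF' eF'].
exists (fun x => if (0 < G x)%N then F x else F' x).
  apply: (@recf_if 1) => //.
  apply: (@eq_recf _ (fun v => 1 - (1 - G (nth 0%N v 0)))%N) => [v _|]; first by case: (G _).
  apply: (recf_ap2 recf2_sub); first exact: recf_const.
  by apply: (recf_ap2 recf2_sub); first exact: recf_const.
by move=> a; rewrite eF eF' eG; case: (b a).
Qed.

Lemma comp_nat2 (h : nat -> nat -> nat) (A : countType) (f g : A -> nat) :
  recf2 h -> computable f -> computable g -> computable (fun a => h (f a) (g a)).
Proof.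
move=> hh [F hF eF] [G hG eG]; exists (fun x => h (F x) (G x)); first exact: (recf_ap2 hh hF hG).
by move=> a; rewrite eF eG.
Qed.

Section CompNat.
Variable A : countType.
Implicit Types (f g : A -> nat) (b c : A -> bool).

Lemma comp_add f g : computable f -> computable g -> computable (fun a => f a + g a)%N.
Proof. exact: comp_nat2 recf2_add. Qed.
Lemma comp_sub f g : computable f -> computable g -> computable (fun a => f a - g a)%N.
Proof. exact: comp_nat2 recf2_sub. Qed.
Lemma comp_mul f g : computable f -> computable g -> computable (fun a => f a * g a)%N.
Proof. exact: comp_nat2 recf2_mul. Qed.
Lemma comp_exp f g : computable f -> computable g -> computable (fun a => f a ^ g a)%N.
Proof. exact: comp_nat2 recf2_exp. Qed.
Lemma comp_S f : computable f -> computable (fun a => (f a).+1).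
Proof.
move=> hf; apply: (@eq_computable _ _ (fun a => f a + 1)%N) => [a|]; first by rewrite addn1.
by apply: comp_add => //; apply: comp_const.
Qed.
Lemma comp_half f : computable f -> computable (fun a => (f a)./2).
Proof. by move=> [F hF eF]; exists (fun x => (F x)./2); [apply: (recf_ap1 recf1_half)|move=> a; rewrite eF]. Qed.
Lemma comp_odd f : computable f -> computable (fun a => odd (f a)).
Proof. by move=> [F hF eF]; exists (fun x => odd (F x) : nat); [apply: (recf_ap1 recf1_odd)|move=> a; rewrite eF]. Qed.
Lemma comp_leq f g : computable f -> computable g -> computable (fun a => f a <= g a)%N.
Proof.
move=> hf hg; apply: (@comp_code _ _ _ _ (fun a => 1 - (f a - g a))%N).
  by apply: comp_sub; [apply: comp_const|apply: comp_sub].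
by move=> a; rewrite /leq; case: (f a - g a)%N.
Qed.
Lemma comp_not b : computable b -> computable (fun a => ~~ b a).
Proof. by move=> hb; apply: comp_if => //; apply: comp_const. Qed.
Lemma comp_and b c : computable b -> computable c -> computable (fun a => b a && c a).
Proof. by move=> hb hc; apply: comp_if => //; apply: comp_const. Qed.
Lemma comp_or b c : computable b -> computable c -> computable (fun a => b a || c a).
Proof. by move=> hb hc; apply: comp_if => //; apply: comp_const. Qed.
Lemma comp_natb b : computable b -> computable (fun a => b a : nat).
Proof. by move=> hb; apply: (comp_code hb). Qed.
Lemma comp_eqn f g : computable f -> computable g -> computable (fun a => f a == g a).
Proof.
move=> hf hg; apply: (@eq_computable _ _ (fun a => (f a <= g a) && (g a <= f a))%N).
  by move=> a; rewrite eqn_leq.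
by apply: comp_and; apply: comp_leq.
Qed.

End CompNat.

Lemma comp_iter (A B : countType) (n : A -> nat) (f : A -> B -> B) (z : A -> B) :
  computable n -> computable (fun p : A * B => f p.1 p.2) -> computable z ->
  computable (fun a => iter (n a) (f a) (z a)).
Proof.
move=> [N hN eN] [F hF eF] [Z hZ eZ].
exists (fun x => iteri (N x) (fun i r => F (CodeSeq.code [:: x; r])) (Z x)).
  apply: (@recf_iteri 1 _ _ (fun i r v => F (CodeSeq.code [:: nth 0%N v 0; r]))) => //.
  apply: (recf_ap1 hF); apply: (recf_ap2 recf2_cons).
    by apply: eq_recf (recf_nth _ 2) => v _; rewrite nth_drop.
  by apply: (recf_ap2 recf2_cons); [apply: recf_nth|apply: recf_const].
move=> a; rewrite eN eZ -[pickle (n a)]/(n a).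
by elim: (n a) => [//|k /= ->]; rewrite (eF (a, _)).
Qed.

Lemma comp_pickle (A B : countType) (f : A -> B) : computable f -> computable (fun a => pickle (f a)).
Proof. by move=> hf; apply: (comp_code hf). Qed.

Lemma comp_cons (A B : countType) (f : A -> B) s : computable f -> computable s -> computable (fun a => f a :: s a).
Proof.
move=> [F hF eF] [S hS eS]; exists (fun x => code_cons (F x) (S x)).
  exact: (recf_ap2 recf2_cons).
by move=> a; rewrite eF eS.
Qed.

Lemma comp_behead (A B : countType) (s : A -> seq B) : computable s -> computable (fun a => behead (s a)).
Proof.
move=> [S hS eS]; exists (fun x => code_tail (S x)); first exact: (recf_ap1 recf1_tail).
by move=> a; rewrite eS /code_tail CodeSeq.codeK behead_map.
Qed.

Lemma comp_nilp (A B : countType) (s : A -> seq B) : computable s -> computable (fun a => nilp (s a)).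
Proof.
move=> hs; apply: (@eq_computable _ _ (fun a => pickle (s a) <= 0)%N).
  by move=> a; case: (s a) => //= x s'; rewrite leqNgt muln_gt0 expn_gt0.
by apply: comp_leq; [apply: comp_pickle|apply: comp_const].
Qed.

Lemma comp_head (A B : countType) (d : A -> B) (s : A -> seq B) :
  computable d -> computable s -> computable (fun a => head (d a) (s a)).
Proof.
move=> hd hs.
have [H hH eH] : computable (fun a => if nilp (s a) then pickle (d a) else code_head (pickle (s a))).
  apply: comp_if; [exact: comp_nilp|exact: comp_pickle|].
  have [S hS eS] := hs; exists (fun x => code_head (S x)); first exact: (recf_ap1 recf1_head).
  by move=> a; rewrite eS.
exists H => // a; rewrite eH; case: (s a) => // x s'.
by rewrite -[pickle (x :: s')]/(CodeSeq.code (pickle x :: map pickle s')) /code_head CodeSeq.codeK.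
Qed.

Lemma size_code s : (size s <= CodeSeq.code s)%N.
Proof.
elim: s => //= x s IH; have : (0 < 2 ^ x)%N by rewrite expn_gt0.
by move: (2 ^ x)%N (CodeSeq.code s) IH => a b; nia.
Qed.

Lemma comp_foldl (A B C : countType) (f : A -> C -> B -> C) (z : A -> C) (s : A -> seq B) :
  computable (fun p : A * C * B => f p.1.1 p.1.2 p.2) -> computable z -> computable s ->
  computable (fun a => foldl (f a) (z a) (s a)).
Proof.
move=> hf hz hs.
(* [head] needs a default in [B]; if [B] is empty, every list over it is empty. *)
have [[b0]|nB] := pselect (inhabited B); last first.
  by apply: eq_computable hz => a; case: (s a) => // x; case: nB.
pose step (a : A) (st : seq B * C) := if nilp st.1 then st else (behead st.1, f a st.2 (head b0 st.1)).
apply: (@eq_computable _ _ (fun a => (iter (pickle (s a)) (step a) (s a, z a)).2)) => [a|].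
  have : (size (s a) <= pickle (s a))%N by rewrite -(size_map pickle) size_code.
  move: (pickle (s a)) => n; elim: n (s a) (z a) => [|n IH] [|x t] y hn //=; rewrite -iterS iterSr.
    exact: (IH [::]).
  by rewrite /step /= IH.
apply: comp_snd; apply: comp_iter; [exact: comp_pickle| |exact: comp_pair].
apply: comp_if; [by apply/comp_nilp/comp_fst/comp_snd/comp_id|by apply/comp_snd/comp_id|].
apply: comp_pair; first by apply/comp_behead/comp_fst/comp_snd/comp_id.
have h2 : computable (fun p : A * (seq B * C) => (p.1, p.2.2, head b0 p.2.1)).
  apply: comp_pair; last by apply: comp_head; [apply: comp_const|apply/comp_fst/comp_snd/comp_id].
  by apply: comp_pair; [apply/comp_fst/comp_id|apply/comp_snd/comp_snd/comp_id].
exact: comp_ap hf h2.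
Qed.

(** No bound on the search is known in advance: that [m] is total and gives the least witness is
    what makes [PMu] converge to it. *)
Lemma comp_search (P : nat -> nat -> bool) (m : nat -> nat) :
  computable (fun p : nat * nat => P p.1 p.2) ->
  (forall n, P n (m n) /\ forall i, (i < m n)%N -> ~~ P n i) -> computable m.
Proof.
move=> [F hF eF] hm; exists m => //.
apply: (@recf_mu 1 (fun i v => 1 - F (CodeSeq.code [:: nth 0 v 0; i]))%N).
  apply: (recf_ap2 recf2_sub); first exact: recf_const.
  apply: (recf_ap1 hF); apply: (recf_ap2 recf2_cons).
    by apply: eq_recf (recf_nth _ 1) => v _; rewrite nth_behead.
  by apply: (recf_ap2 recf2_cons); [apply: recf_nth|apply: recf_const].
move=> v _; have [h1 h2] := hm (nth 0%N v 0); rewrite (eF (_, _)) /= h1.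
by split=> // i hi; rewrite (eF (_, _)) /= (negbTE (h2 _ hi)).
Qed.

Lemma comp_foldr (A B C : countType) (f : A -> B -> C -> C) (z : A -> C) (s : A -> seq B) :
  computable (fun p : A * B * C => f p.1.1 p.1.2 p.2) -> computable z -> computable s ->
  computable (fun a => foldr (f a) (z a) (s a)).
Proof.
move=> hf hz hs.
apply: (@eq_computable _ _ (fun a => foldl (fun x y => f a y x) (z a) (foldl (fun t y => y :: t) [::] (s a)))).
  move=> a; rewrite -foldl_rev; congr foldl.
  by rewrite /rev; elim: (s a) [::] => //= x t IH u; rewrite -IH.
apply: comp_foldl => //.
  have h2 : computable (fun p : A * C * B => (p.1.1, p.2, p.1.2)).
    by apply: comp_pair; [apply: comp_pair|];
      [apply/comp_fst/comp_fst/comp_id|apply/comp_snd/comp_id|apply/comp_snd/comp_fst/comp_id].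
  exact: comp_ap hf h2.
apply: (@comp_foldl _ _ _ (fun a t y => y :: t)) => //; last exact: comp_const.
by apply: comp_cons; [apply/comp_snd/comp_id|apply/comp_snd/comp_fst/comp_id].
Qed.

Lemma comp_map (A B C : countType) (f : A -> B -> C) (s : A -> seq B) :
  computable (fun p : A * B => f p.1 p.2) -> computable s -> computable (fun a => [seq f a x | x <- s a]).
Proof.
move=> hf hs; apply: (@comp_foldr A B (seq C) (fun a x t => f a x :: t)) => //; last exact: comp_const.
by apply: comp_cons; [apply: (comp_ap hf); apply/comp_fst/comp_id|apply/comp_snd/comp_id].
Qed.

Lemma comp_all (A B : countType) (f : A -> B -> bool) (s : A -> seq B) :
  computable (fun p : A * B => f p.1 p.2) -> computable s -> computable (fun a => all (f a) (s a)).
Proof.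
move=> hf hs; apply: (@eq_computable _ _ (fun a => foldr (fun x b => f a x && b) true (s a))).
  by move=> a; elim: (s a) => //= x t ->.
apply: (@comp_foldr A B bool (fun a x t => f a x && t)) => //; last exact: comp_const.
by apply: comp_and; [apply: (comp_ap hf); apply/comp_fst/comp_id|apply/comp_snd/comp_id].
Qed.

Lemma comp_size (A B : countType) (s : A -> seq B) : computable s -> computable (fun a => size (s a)).
Proof.
move=> hs; apply: (@eq_computable _ _ (fun a => foldr (fun x n => n.+1) 0%N (s a))).
  by move=> a; elim: (s a) => //= x t ->.
apply: (@comp_foldr A B nat (fun a x t => t.+1)) => //; last exact: comp_const.
by apply/comp_S/comp_snd/comp_id.
Qed.

Lemma comp_count (A B : countType) (f : A -> B -> bool) (s : A -> seq B) :
  computable (fun p : A * B => f p.1 p.2) -> computable s -> computable (fun a => count (f a) (s a)).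
Proof.
move=> hf hs; apply: (@eq_computable _ _ (fun a => foldr (fun x n => f a x + n)%N 0%N (s a))).
  by move=> a; elim: (s a) => //= x t ->.
apply: (@comp_foldr A B nat (fun a x t => f a x + t)%N) => //; last exact: comp_const.
by apply: comp_add; [apply/comp_natb/(comp_ap hf)/comp_fst/comp_id|apply/comp_snd/comp_id].
Qed.

Lemma comp_drop (A B : countType) (n : A -> nat) (s : A -> seq B) : computable n -> computable s ->
  computable (fun a => drop (n a) (s a)).
Proof.
move=> hn hs; apply: (@eq_computable _ _ (fun a => iter (n a) behead (s a))).
  move=> a; elim: (n a) => [|k IH]; first by rewrite drop0.
  by rewrite iterS IH -[_.+1]add1n -drop_drop drop1.
apply: comp_iter => //; exact/comp_behead/comp_snd/comp_id.
Qed.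

Lemma comp_nth (A B : countType) (d : A -> B) (s : A -> seq B) (n : A -> nat) :
  computable d -> computable s -> computable n -> computable (fun a => nth (d a) (s a) (n a)).
Proof.
move=> hd hs hn; apply: (@eq_computable _ _ (fun a => head (d a) (drop (n a) (s a)))).
  by move=> a; rewrite -nth0 nth_drop addn0.
by apply: comp_head => //; apply: comp_drop.
Qed.

Lemma comp_iota (A : countType) (n : A -> nat) : computable n -> computable (fun a => iota 0 (n a)).
Proof.
move=> hn.
apply: (@eq_computable _ _ (fun a => (iter (n a) (fun p : nat * seq nat => (p.1.-1, p.1.-1 :: p.2)) (n a, [::])).2)).
  move=> a; suff H k : (k <= n a)%N -> iter k (fun p : nat * seq nat => (p.1.-1, p.1.-1 :: p.2)) (n a, [::])
    = ((n a - k)%N, iota (n a - k) k) by rewrite H // subnn.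
  elim: k => [|k IH] hk; first by rewrite subn0.
  rewrite iterS IH ?(ltnW hk) //= subnS; congr (_, _ :: iota _ _); lia.
apply: comp_snd; apply: comp_iter => //; last by apply: comp_pair => //; apply: comp_const.
have hp : computable (fun p : A * (nat * seq nat) => p.2.1.-1).
  apply: (@eq_computable _ _ (fun p : A * (nat * seq nat) => p.2.1 - 1)%N) => [p|]; first by rewrite subn1.
  by apply: comp_sub; [apply/comp_fst/comp_snd/comp_id|apply: comp_const].
by apply: comp_pair => //; apply: comp_cons => //; apply/comp_snd/comp_snd/comp_id.
Qed.

Lemma comp_some (A B : countType) (f : A -> B) : computable f -> computable (fun a => Some (f a)).
Proof.
move=> hf; apply: (@comp_code _ _ _ _ (fun a => [:: f a])) => //.
by apply: comp_cons => //; apply: comp_const.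
Qed.

Lemma comp_oapp (A B C : countType) (f : A -> B -> C) (z : A -> C) (o : A -> option B) :
  computable (fun p : A * B => f p.1 p.2) -> computable z -> computable o ->
  computable (fun a => oapp (f a) (z a) (o a)).
Proof.
move=> hf hz ho; apply: (@eq_computable _ _ (fun a => foldr (fun x _ => f a x) (z a) (seq_of_opt (o a)))).
  by move=> a; case: (o a).
apply: (@comp_foldr A B C (fun a x t => f a x)) => //.
by apply: (comp_ap hf); apply/comp_fst/comp_id.
Qed.

(** * Integers and rationals through their codes *)

Lemma comp_Posz (A : countType) (f : A -> nat) : computable f -> computable (fun a => Posz (f a)).
Proof.
move=> hf; apply: (@comp_code _ _ _ _ (fun a => (Some (f a), None : option nat))) => //.
by apply: comp_pair; [apply: comp_some|apply: comp_const].
Qed.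

Lemma comp_Negz (A : countType) (f : A -> nat) : computable f -> computable (fun a => Negz (f a)).
Proof.
move=> hf; apply: (@comp_code _ _ _ _ (fun a => (None : option nat, Some (f a)))) => //.
by apply: comp_pair; [apply: comp_const|apply: comp_some].
Qed.

(** The form in which an integer is pickled, with [Posz n] stored as [(Some n, None)] and [Negz n]
    as [(None, Some n)]. Arithmetic is reduced to differences [zpos - zneg] of natural numbers. *)
Definition int_opair (z : int) : option nat * option nat := opair_of_sum (natsum_of_int z).

Definition zpos (z : int) : nat := odflt 0%N (int_opair z).1.
Definition zneg (z : int) : nat := oapp succn 0%N (int_opair z).2.
Definition zdiff (m n : nat) : int := if (n <= m)%N then Posz (m - n) else Negz ((n - m) - 1).

Lemma zdiffE m n : zdiff m n = m%:Z - n%:Z.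
Proof. rewrite /zdiff; case: leqP; lia. Qed.
Lemma zposE z : z = (zpos z)%:Z - (zneg z)%:Z.
Proof. by case: z => n; rewrite /zpos /zneg /=; lia. Qed.

Section CompInt.
Variable A : countType.
Implicit Types (x y : A -> int).

Lemma comp_zpos x : computable x -> computable (fun a => zpos (x a)).
Proof.
move=> hx; apply: (@comp_oapp A nat nat (fun _ n => n)); [exact/comp_snd/comp_id|exact: comp_const|].
by apply: comp_fst; apply: (comp_code hx).
Qed.

Lemma comp_zneg x : computable x -> computable (fun a => zneg (x a)).
Proof.
move=> hx; apply: (@comp_oapp A nat nat (fun _ n => n.+1)); [exact/comp_S/comp_snd/comp_id|exact: comp_const|].
by apply: comp_snd; apply: (comp_code hx).
Qed.

Lemma comp_zdiff (f g : A -> nat) : computable f -> computable g -> computable (fun a => zdiff (f a) (g a)).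
Proof.
move=> hf hg; apply: comp_if; first exact: comp_leq.
  by apply/comp_Posz/comp_sub.
by apply/comp_Negz/comp_sub; [apply: comp_sub|apply: comp_const].
Qed.

Lemma comp_addz x y : computable x -> computable y -> computable (fun a => x a + y a).
Proof.
move=> hx hy.
apply: (@eq_computable _ _ (fun a => zdiff (zpos (x a) + zpos (y a)) (zneg (x a) + zneg (y a)))).
  by move=> a; rewrite zdiffE [in RHS](zposE (x a)) [in RHS](zposE (y a)); lia.
by apply: comp_zdiff; apply: comp_add; do ?[exact: comp_zpos|exact: comp_zneg].
Qed.

Lemma comp_oppz x : computable x -> computable (fun a => - x a).
Proof.
move=> hx; apply: (@eq_computable _ _ (fun a => zdiff (zneg (x a)) (zpos (x a)))).
  by move=> a; rewrite zdiffE [in RHS](zposE (x a)); lia.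
by apply: comp_zdiff; [exact: comp_zneg|exact: comp_zpos].
Qed.

Lemma comp_mulz x y : computable x -> computable y -> computable (fun a => x a * y a).
Proof.
move=> hx hy.
apply: (@eq_computable _ _ (fun a => zdiff (zpos (x a) * zpos (y a) + zneg (x a) * zneg (y a))
   (zpos (x a) * zneg (y a) + zneg (x a) * zpos (y a)))).
  by move=> a; rewrite zdiffE [in RHS](zposE (x a)) [in RHS](zposE (y a)); nia.
by apply: comp_zdiff; apply: comp_add; apply: comp_mul; do ?[exact: comp_zpos|exact: comp_zneg].
Qed.

Lemma comp_lez x y : computable x -> computable y -> computable (fun a => x a <= y a).
Proof.
move=> hx hy.
apply: (@eq_computable _ _ (fun a => zpos (x a) + zneg (y a) <= zpos (y a) + zneg (x a))%N).
  by move=> a; rewrite [in RHS](zposE (x a)) [in RHS](zposE (y a)); lia.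
by apply: comp_leq; apply: comp_add; do ?[exact: comp_zpos|exact: comp_zneg].
Qed.

Lemma comp_ltz x y : computable x -> computable y -> computable (fun a => x a < y a).
Proof.
move=> hx hy; apply: (@eq_computable _ _ (fun a => ~~ (y a <= x a))).
  by move=> a; rewrite ltNge.
by apply/comp_not/comp_lez.
Qed.

Lemma comp_absz x : computable x -> computable (fun a => `|x a|%N).
Proof.
move=> hx; apply: (@eq_computable _ _ (fun a => zpos (x a) + zneg (x a))%N).
  by move=> a; case: (x a) => n; rewrite /zpos /zneg /= ?addn0.
by apply: comp_add; do ?[exact: comp_zpos|exact: comp_zneg].
Qed.

Lemma comp_eqz x y : computable x -> computable y -> computable (fun a => x a == y a).
Proof.
move=> hx hy; apply: (@eq_computable _ _ (fun a => (x a <= y a) && (y a <= x a))).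
  by move=> a; rewrite eq_le.
by apply: comp_and; apply: comp_lez.
Qed.

End CompInt.

Lemma comp_intq (A : countType) (x : A -> int) : computable x -> computable (fun a => (x a)%:~R : rat).
Proof.
move=> hx; apply: (@comp_code _ _ _ _ (fun a => (x a, 1 : int))).
  by apply: comp_pair => //; apply: comp_const.
move=> a; rewrite -[LHS]/(pickle (valq _)); congr pickle.
by rewrite [valq _]surjective_pairing -/(numq _) -/(denq _) numq_int denq_int.
Qed.

Lemma comp_numq (A : countType) (x : A -> rat) : computable x -> computable (fun a => numq (x a)).
Proof. by move=> hx; apply: comp_fst; apply: (comp_code hx). Qed.

Lemma comp_denq (A : countType) (x : A -> rat) : computable x -> computable (fun a => denq (x a)).
Proof. by move=> hx; apply: comp_snd; apply: (comp_code hx). Qed.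

(** * Decoding *)

Lemma comp_decode (A : countType) (f : A -> nat) : computable f -> computable (fun a => CodeSeq.decode (f a)).
Proof.
move=> hf; apply: (comp_code hf) => a.
by rewrite -[LHS]/(CodeSeq.code (map id _)) map_id CodeSeq.decodeK.
Qed.

(** A decoder must recognize which numbers are codes, so its computability is proved type by type.
    It is needed to read the given test and the candidates of a search. *)
Definition comp_unpickle (T : countType) := computable (fun n : nat => unpickle n : option T).

Lemma comp_unpickle_ap (T A : countType) (f : A -> nat) : comp_unpickle T -> computable f ->
  computable (fun a => unpickle (f a) : option T).
Proof. by move=> hT; apply: comp_ap. Qed.

(* Goals are matched syntactically: unifying with [apply] alone would unfold
   integer arithmetic. *)
Ltac comp_user := fail.
Ltac comp_step := cbv beta; lazymatch goal with
  | |- computable (fun e => e) => apply comp_id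
  | |- computable fst => exact (comp_fst (comp_id _))
  | |- computable snd => exact (comp_snd (comp_id _))
  | |- computable (fun e => fst (@?f e)) => apply (@comp_fst _ _ _ f)
  | |- computable (fun e => snd (@?f e)) => apply (@comp_snd _ _ _ f)
  | |- computable (fun e => pair (@?f e) (@?g e)) => apply (@comp_pair _ _ _ f g)
  | |- computable (fun e => if _ then _ else _) => apply comp_if
  | |- computable (fun e => addn (@?f e) (@?g e)) => apply (@comp_add _ f g)
  | |- computable (fun e => subn (@?f e) (@?g e)) => apply (@comp_sub _ f g)
  | |- computable (fun e => muln (@?f e) (@?g e)) => apply (@comp_mul _ f g)
  | |- computable (fun e => expn (@?f e) (@?g e)) => apply (@comp_exp _ f g)
  | |- computable (fun e => S (@?f e)) => apply (@comp_S _ f)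
  | |- computable (fun e => half (@?f e)) => apply (@comp_half _ f)
  | |- computable (fun e => odd (@?f e)) => apply (@comp_odd _ f)
  | |- computable (fun e => leq (@?f e) (@?g e)) => apply (@comp_leq _ f g)
  | |- computable (fun e => negb (@?f e)) => apply (@comp_not _ f)
  | |- computable (fun e => andb (@?f e) (@?g e)) => apply (@comp_and _ f g)
  | |- computable (fun e => orb (@?f e) (@?g e)) => apply (@comp_or _ f g)
  | |- computable (fun e => nat_of_bool (@?f e)) => apply (@comp_natb _ f)
  | |- computable (fun e => @eq_op _ (@?f e) (@?g e)) => first [apply (@comp_eqn _ f g) | apply (@comp_eqz _ f g)]
  | |- computable (fun e => iter (@?n e) (@?f e) (@?z e)) => apply (@comp_iter _ _ n f z)
  | |- computable (fun e => cons (@?f e) (@?s e)) => apply (@comp_cons _ _ f s)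
  | |- computable (fun e => behead (@?s e)) => apply (@comp_behead _ _ s)
  | |- computable (fun e => foldr (@?f e) (@?z e) (@?s e)) => apply (@comp_foldr _ _ _ f z s)
  | |- computable (fun e => map (@?f e) (@?s e)) => apply (@comp_map _ _ _ f s)
  | |- computable (fun e => all (@?f e) (@?s e)) => apply (@comp_all _ _ f s)
  | |- computable (fun e => count (@?f e) (@?s e)) => apply (@comp_count _ _ f s)
  | |- computable (fun e => size (@?s e)) => apply (@comp_size _ _ s)
  | |- computable (fun e => drop (@?n e) (@?s e)) => apply (@comp_drop _ _ n s)
  | |- computable (fun e => nth (@?d e) (@?s e) (@?n e)) => apply (@comp_nth _ _ d s n)
  | |- computable (fun e => iota 0 (@?n e)) => apply (@comp_iota _ n)
  | |- computable (fun e => Some (@?f e)) => apply (@comp_some _ _ f)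
  | |- computable (fun e => oapp (@?f e) (@?z e) (@?o e)) => apply (@comp_oapp _ _ _ f z o)
  | |- computable (fun e => Posz (@?f e)) => apply (@comp_Posz _ f)
  | |- computable (fun e => Negz (@?f e)) => apply (@comp_Negz _ f)
  | |- computable (fun e => absz (@?f e)) => apply (@comp_absz _ f)
  | |- computable (fun e => GRing.add (@?f e) (@?g e)) => apply (@comp_addz _ f g)
  | |- computable (fun e => GRing.opp (@?f e)) => apply (@comp_oppz _ f)
  | |- computable (fun e => GRing.mul (@?f e) (@?g e)) => apply (@comp_mulz _ f g)
  | |- computable (fun e => Order.le (@?f e) (@?g e)) => apply (@comp_lez _ f g)
  | |- computable (fun e => Order.lt (@?f e) (@?g e)) => apply (@comp_ltz _ f g)
  | |- computable (fun e => numq (@?f e)) => apply (@comp_numq _ f)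
  | |- computable (fun e => denq (@?f e)) => apply (@comp_denq _ f)
  | |- computable (fun e => intmul 1 (@?f e)) => apply (@comp_intq _ f)
  | |- computable (fun e => CodeSeq.decode (@?f e)) => apply (@comp_decode _ f)
  | |- computable (fun e => @unpickle ?T (@?f e)) => apply (@comp_unpickle_ap T _ f)
  | |- comp_unpickle _ => assumption
  | |- _ => first [comp_user | lazymatch goal with |- @computable ?A ?B (fun _ => ?c) => exact (@comp_const A B c) end]
  end.
Ltac comp_tac := repeat comp_step.

Lemma comp_unpickle_nat : comp_unpickle nat.
Proof. exact: (comp_some (comp_id nat)). Qed.

Lemma comp_pmap_unpickle (T : countType) : comp_unpickle T ->
  computable (fun n => pmap (unpickle : nat -> option T) (CodeSeq.decode n)).
Proof.
move=> hT.
apply: (@eq_computable _ _ (fun n => foldr (fun x r => oapp (fun y => y :: r) r (unpickle x : option T)) [::] (CodeSeq.decode n))).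
  by move=> n; elim: (CodeSeq.decode n) => //= x s ->.
by comp_tac.
Qed.

Lemma comp_unpickle_seq (T : countType) : comp_unpickle T -> comp_unpickle (seq T).
Proof. by move=> hT; apply/comp_some/comp_pmap_unpickle. Qed.

Lemma comp_unpickle_option (T : countType) : comp_unpickle T -> comp_unpickle (option T).
Proof.
move=> hT; apply: comp_some.
apply: (@eq_computable _ _ (fun n => foldr (fun x _ => Some x) None (pmap (unpickle : nat -> option T) (CodeSeq.decode n)))).
  by move=> n; case: pmap.
by comp_tac; apply: comp_pmap_unpickle.
Qed.

Lemma unpickle_pairE (A B : countType) n : (unpickle n : option (A * B)) =
  let s := CodeSeq.decode n in if size s == 2 then
  oapp (fun a => oapp (fun b => Some (a, b)) None (unpickle (nth 0%N s 1))) None (unpickle (nth 0%N s 0))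
  else None.
Proof.
rewrite -[LHS]/(obind (some \o @pair_of_tag A B) (@unpickle_tagged A (fun=> B) n)) /unpickle_tagged.
case: CodeSeq.decode => [|x [|y [|z s]]] //=.
by case: (unpickle x) => //= a; case: (unpickle y).
Qed.

Lemma comp_unpickle_pair (A B : countType) : comp_unpickle A -> comp_unpickle B ->
  comp_unpickle (A * B)%type.
Proof.
move=> hA hB; apply: (eq_computable (fun n => esym (@unpickle_pairE A B n))) => /=.
by comp_tac.
Qed.

Lemma comp_unpickle_int : comp_unpickle int.
Proof.
apply: (@eq_computable _ _ (fun n => oapp (fun p : option nat * option nat =>
   oapp (fun m => Some (Negz m)) (oapp (fun m => Some (Posz m)) None p.1) p.2) None
   (unpickle n : option (option nat * option nat)))).
  move=> n; rewrite -[RHS]/(omap int_of_natsum (obind (@sum_of_opair _ _) (unpickle n))).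
  by case: unpickle => // -[[a|] [b|]].
comp_tac.
by apply: comp_unpickle_pair;
  apply: comp_unpickle_option; apply: comp_unpickle_nat.
Qed.

(** Decoding a rational requires checking that its fraction is reduced. Bounded quantification needs
    only multiplication and spares an analysis of the Euclidean algorithm. *)
Definition bounded_coprime a b :=
  all (fun d => all (fun k => all (fun l => ~~ [&& d * k == a, d * l == b & 1 < d]%N)
    (iota 0 (a + b).+1)) (iota 0 (a + b).+1)) (iota 0 (a + b).+1).
Arguments bounded_coprime : simpl never.

Lemma bounded_coprimeE a b : (0 < b)%N -> bounded_coprime a b = coprime a b.
Proof.
move=> b0; apply/esym; apply/idP/allP => [cab d _|H].
  apply/allP => k _; apply/allP => l _; apply/negP => /and3P[/eqP ea /eqP eb d1].
  have : (d %| gcdn a b)%N by rewrite dvdn_gcd -ea -eb !dvdn_mulr.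
  by move: cab; rewrite /coprime => /eqP->; rewrite dvdn1; lia.
have g0 : (0 < gcdn a b)%N by rewrite gcdn_gt0 b0 orbT.
have /dvdnP[k ek] := dvdn_gcdl a b; have /dvdnP[l el] := dvdn_gcdr a b.
rewrite /coprime; set g := gcdn a b in g0 ek el *.
have gb : (g <= b)%N by rewrite dvdn_leq ?dvdn_gcdr.
have ka : (k <= a)%N by rewrite ek leq_pmulr.
have lb : (l <= b)%N by rewrite el leq_pmulr.
have /H/allP/(_ k)/[!mem_iota] Hk : g \in iota 0 (a + b).+1 by rewrite mem_iota; lia.
have /Hk/allP/(_ l)/[!mem_iota] Hl : (0 <= k < 0 + (a + b).+1)%N by lia.
have /Hl : (0 <= l < 0 + (a + b).+1)%N by lia.
apply: contraR => g1; apply/and3P; split; [by rewrite mulnC -ek|by rewrite mulnC -el|lia].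
Qed.

Lemma comp_unpickle_rat : comp_unpickle rat.
Proof.
apply: (@comp_code _ _ _ _ (fun n => oapp (fun p : int * int => if (0 < p.2) && bounded_coprime `|p.1|%N `|p.2|%N
   then Some p else None) None
   (unpickle n : option (int * int)))).
  rewrite /bounded_coprime; comp_tac.
  by apply: comp_unpickle_pair; apply: comp_unpickle_int.
move=> n; rewrite -[@unpickle rat n]/(obind insub (unpickle n)).
case: unpickle => //= p; case: insubP => [q hq eq|].
  move: hq => /andP[h0 h1]; rewrite h0 bounded_coprimeE; last by rewrite absz_gt0 gt_eqF.
  by rewrite h1 -eq.
rewrite negb_and; case: (0 < p.2) / idP => //= h0.
by rewrite bounded_coprimeE ?absz_gt0 ?gt_eqF // => /negbTE->.
Qed.

(** * The approximation test *)

Local Notation gint := (int * int)%type.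
Local Notation ecode := (seq int * (rat * rat * rat * rat))%type.

Definition gadd (x y : gint) : gint := (x.1 + y.1, x.2 + y.2).
Definition gmul (x y : gint) : gint := (x.1 * y.1 - x.2 * y.2, x.1 * y.2 + x.2 * y.1).
Definition gconj (x : gint) : gint := (x.1, - x.2).
Definition gscale (c : int) (x : gint) : gint := (c * x.1, c * x.2).
Definition gnorm2 (x : gint) : int := x.1 * x.1 + x.2 * x.2.
Definition gnth (u : seq gint) i := nth (0, 0) u i.

Definition ginner (u v : seq gint) : gint :=
  foldr (fun i acc => gadd (gmul (gconj (gnth u i)) (gnth v i)) acc) (0, 0) (iota 0 (size u)).
Definition gsqnorm (u : seq gint) : int := foldr (fun x acc => gnorm2 x + acc) 0 u.

Definition orthogonal_family (d : nat) (us : seq (seq gint)) : bool :=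
  all (fun u => (size u == d) && (0 < gsqnorm u)) us &&
  all (fun i => all (fun j => (j <= i)%N ||
    (((ginner (nth [::] us i) (nth [::] us j)).1 == 0) &&
     ((ginner (nth [::] us i) (nth [::] us j)).2 == 0)))
    (iota 0 (size us))) (iota 0 (size us)).

(* Numerator and denominator of the [(i, j)] entry of the projection onto the
   span of an orthogonal family. *)
Definition proj_frac (us : seq (seq gint)) (i j : nat) : gint * int :=
  foldr (fun u acc => (gadd (gscale (gsqnorm u) acc.1)
                         (gscale acc.2 (gmul (gnth u i) (gconj (gnth u j)))),
                       acc.2 * gsqnorm u)) ((0, 0), 1) us.

(** Since a rational is at most its numerator in absolute value, this integer bounds the modulus of
    all points of the box, and every such point is within [2 * box_bound e / N] of the grid. *)
Definition box_bound (e : ecode) : nat :=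
  (`|numq e.2.1.1.1| + `|numq e.2.1.1.2| + `|numq e.2.1.2| + `|numq e.2.2|)%N.+1.

(* On the disc of radius [M], the first component bounds the polynomial with
   coefficients [cs] and the second one is a Lipschitz constant for it. *)
Definition poly_bounds (M : nat) (cs : seq int) : nat * nat :=
  foldr (fun c acc => (`|c| + M * acc.1, M * acc.2 + acc.1)%N) (0%N, 0%N) cs.

(** Scaled so that [entry_lip e / N] bounds the modulus of the polynomial at the grid point next to
    a root in the box. *)
Definition entry_lip (e : ecode) : nat :=
  (2 * box_bound e * (poly_bounds (box_bound e) e.1).2)%N.

(** All grid points are put over one denominator, dividing the sides of the box in the ratios
    [i : N - i] and [j : N - j]; every later test is then about integers. *)
Definition grid_den (e : ecode) (N : nat) : int :=
  denq e.2.1.1.1 * denq e.2.1.1.2 * denq e.2.1.2 * denq e.2.2 * N%:Z.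
Definition grid_num (e : ecode) (N i j : nat) : gint :=
  ((numq e.2.1.1.1 * denq e.2.1.1.2 * (N - i)%N%:Z + numq e.2.1.1.2 * denq e.2.1.1.1 * i%:Z)
     * (denq e.2.1.2 * denq e.2.2),
   (numq e.2.1.2 * denq e.2.2 * (N - j)%N%:Z + numq e.2.2 * denq e.2.1.2 * j%:Z)
     * (denq e.2.1.1.1 * denq e.2.1.1.2)).

(* Homogenized Horner scheme: [((Q ^ size cs) * p(W / Q), Q ^ size cs)]. *)
Definition horner_hom (cs : seq int) (W : gint) (Q : int) : gint * int :=
  foldr (fun c acc => (gadd (c * (acc.2 * Q), 0) (gmul W acc.1), acc.2 * Q)) ((0, 0), 1) cs.

(** Squared and cleared of denominators, this says that the polynomial at the grid point exceeds
    [entry_lip e / N] in modulus; in the same way [grid_near] says that the point is within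
    [1 / (2 T)] of [P]. *)
Definition grid_far (e : ecode) (N : nat) (W : gint) : bool :=
  (entry_lip e)%:Z * (entry_lip e)%:Z *
    ((horner_hom e.1 W (grid_den e N)).2 * (horner_hom e.1 W (grid_den e N)).2)
  < gnorm2 (horner_hom e.1 W (grid_den e N)).1 * (N%:Z * N%:Z).

Definition grid_near (e : ecode) (P : gint * int) (T N : nat) (W : gint) : bool :=
  gnorm2 (gadd (gscale P.2 W) (gscale (- grid_den e N) P.1)) * ((2 * T)%N%:Z * (2 * T)%N%:Z)
  <= (grid_den e N * P.2) * (grid_den e N * P.2).

(* Certificate, at grid resolution [N], that the root isolated by [e] is within
   [1 / T] of the fraction [P]: away from [P] the polynomial is too large at the
   grid points of the box to vanish nearby. *)
Definition entry_test (e : ecode) (P : gint * int) (T N : nat) : bool :=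
  (4 * box_bound e * T < N)%N &&
  all (fun i => all (fun j => grid_far e N (grid_num e N i j) || grid_near e P T N (grid_num e N i j))
     (iota 0 N.+1)) (iota 0 N.+1).

(** There are [4^n] entries, so a precision of [2^-(2 n + k)] for each leaves an error of order
    [2^-k] in a sum over all of them. *)
Definition proj_test (k n : nat) (d : seq (seq ecode)) (us : seq (seq gint)) (N : nat) : bool :=
  orthogonal_family (2 ^ n) us &&
  all (fun i => all (fun j =>
      entry_test (nth ([::], (0, 0, 0, 0)) (nth [::] d i) j) (proj_frac us i j) (2 ^ (2 * n + k)) N)
    (iota 0 (2 ^ n))) (iota 0 (2 ^ n)).

(* Codes the entry [(a + ib) / sqrt s]: it is a root of
   [s^2 X^4 - 2 (a^2 - b^2) s X^2 + (a^2 + b^2)^2], whose other roots lie in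
   other quadrants. *)
Definition unit_entry (s : int) (x : gint) : ecode :=
  ([:: gnorm2 x * gnorm2 x; 0; - (2%:Z * (x.1 * x.1 - x.2 * x.2) * s); 0; s * s],
   ((if x.1 < 0 then x.1 else 0)%:~R, (if 0 < x.1 then x.1 else 0)%:~R,
    (if x.2 < 0 then x.2 else 0)%:~R, (if 0 < x.2 then x.2 else 0)%:~R)).

Definition unit_family (us : seq (seq gint)) : seq (seq ecode) :=
  [seq [seq unit_entry (gsqnorm u) x | x <- u] | u <- us].

(** * Computability of the approximation test *)

Section CompGauss.
Variable A : countType.
Implicit Types (x y : A -> gint) (u v : A -> seq gint).

Lemma comp_gadd x y : computable x -> computable y -> computable (fun a => gadd (x a) (y a)).
Proof. by move=> hx hy; rewrite /gadd; comp_tac. Qed.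
Lemma comp_gmul x y : computable x -> computable y -> computable (fun a => gmul (x a) (y a)).
Proof. by move=> hx hy; rewrite /gmul; comp_tac. Qed.
Lemma comp_gconj x : computable x -> computable (fun a => gconj (x a)).
Proof. by move=> hx; rewrite /gconj; comp_tac. Qed.
Lemma comp_gscale (c : A -> int) x : computable c -> computable x -> computable (fun a => gscale (c a) (x a)).
Proof. by move=> hc hx; rewrite /gscale; comp_tac. Qed.
Lemma comp_gnorm2 x : computable x -> computable (fun a => gnorm2 (x a)).
Proof. by move=> hx; rewrite /gnorm2; comp_tac. Qed.
Lemma comp_gnth u (i : A -> nat) : computable u -> computable i -> computable (fun a => gnth (u a) (i a)).
Proof. by move=> hu hi; rewrite /gnth; comp_tac. Qed.
End CompGauss.

Ltac comp_gauss := lazymatch goal with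
  | |- computable (fun e => gadd (@?x0 e) (@?x1 e)) => apply (@comp_gadd _ x0 x1)
  | |- computable (fun e => gmul (@?x0 e) (@?x1 e)) => apply (@comp_gmul _ x0 x1)
  | |- computable (fun e => gconj (@?x0 e)) => apply (@comp_gconj _ x0)
  | |- computable (fun e => gscale (@?x0 e) (@?x1 e)) => apply (@comp_gscale _ x0 x1)
  | |- computable (fun e => gnorm2 (@?x0 e)) => apply (@comp_gnorm2 _ x0)
  | |- computable (fun e => gnth (@?x0 e) (@?x1 e)) => apply (@comp_gnth _ x0 x1)
  end.
Ltac comp_user ::= comp_gauss.

Lemma comp_ginner (A : countType) (x0 : A -> seq gint) (x1 : A -> seq gint) :
  computable x0 -> computable x1 ->
  computable (fun a => ginner (x0 a) (x1 a)).
Proof.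
move=> h0 h1; suff H : computable (fun p : (seq gint) * (seq gint) => ginner p.1 p.2).
  exact: (comp_ap H (comp_pair h0 h1)).
by rewrite /ginner; comp_tac.
Qed.

Lemma comp_gsqnorm (A : countType) (x0 : A -> seq gint) :
  computable x0 ->
  computable (fun a => gsqnorm (x0 a)).
Proof.
move=> h0; suff H : computable (fun p : (seq gint) => gsqnorm p).
  exact: (comp_ap H h0).
by rewrite /gsqnorm; comp_tac.
Qed.

Lemma comp_box_bound (A : countType) (x0 : A -> ecode) :
  computable x0 ->
  computable (fun a => box_bound (x0 a)).
Proof.
move=> h0; suff H : computable (fun p : ecode => box_bound p).
  exact: (comp_ap H h0).
by rewrite /box_bound; comp_tac.
Qed.

Lemma comp_poly_bounds (A : countType) (x0 : A -> nat) (x1 : A -> seq int) :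
  computable x0 -> computable x1 ->
  computable (fun a => poly_bounds (x0 a) (x1 a)).
Proof.
move=> h0 h1; suff H : computable (fun p : nat * (seq int) => poly_bounds p.1 p.2).
  exact: (comp_ap H (comp_pair h0 h1)).
by rewrite /poly_bounds; comp_tac.
Qed.

Lemma comp_grid_den (A : countType) (x0 : A -> ecode) (x1 : A -> nat) :
  computable x0 -> computable x1 ->
  computable (fun a => grid_den (x0 a) (x1 a)).
Proof.
move=> h0 h1; suff H : computable (fun p : ecode * nat => grid_den p.1 p.2).
  exact: (comp_ap H (comp_pair h0 h1)).
by rewrite /grid_den; comp_tac.
Qed.

Lemma comp_grid_num (A : countType) (x0 : A -> ecode) (x1 : A -> nat) (x2 : A -> nat) (x3 : A -> nat) :
  computable x0 -> computable x1 -> computable x2 -> computable x3 ->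
  computable (fun a => grid_num (x0 a) (x1 a) (x2 a) (x3 a)).
Proof.
move=> h0 h1 h2 h3; suff H : computable (fun p : ecode * nat * nat * nat => grid_num p.1.1.1 p.1.1.2 p.1.2 p.2).
  exact: (comp_ap H (comp_pair (comp_pair (comp_pair h0 h1) h2) h3)).
by rewrite /grid_num; comp_tac.
Qed.

Lemma comp_horner_hom (A : countType) (x0 : A -> seq int) (x1 : A -> gint) (x2 : A -> int) :
  computable x0 -> computable x1 -> computable x2 ->
  computable (fun a => horner_hom (x0 a) (x1 a) (x2 a)).
Proof.
move=> h0 h1 h2; suff H : computable (fun p : (seq int) * gint * int => horner_hom p.1.1 p.1.2 p.2).
  exact: (comp_ap H (comp_pair (comp_pair h0 h1) h2)).
by rewrite /horner_hom; comp_tac.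
Qed.

Ltac comp_grid := lazymatch goal with
  | |- computable (fun e => ginner (@?x0 e) (@?x1 e)) => apply (@comp_ginner _ x0 x1)
  | |- computable (fun e => gsqnorm (@?x0 e)) => apply (@comp_gsqnorm _ x0)
  | |- computable (fun e => box_bound (@?x0 e)) => apply (@comp_box_bound _ x0)
  | |- computable (fun e => poly_bounds (@?x0 e) (@?x1 e)) => apply (@comp_poly_bounds _ x0 x1)
  | |- computable (fun e => grid_den (@?x0 e) (@?x1 e)) => apply (@comp_grid_den _ x0 x1)
  | |- computable (fun e => grid_num (@?x0 e) (@?x1 e) (@?x2 e) (@?x3 e)) => apply (@comp_grid_num _ x0 x1 x2 x3)
  | |- computable (fun e => horner_hom (@?x0 e) (@?x1 e) (@?x2 e)) => apply (@comp_horner_hom _ x0 x1 x2)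
  end.
Ltac comp_user ::= first [comp_gauss | comp_grid].

Lemma comp_orthogonal_family (A : countType) (x0 : A -> nat) (x1 : A -> seq (seq gint)) :
  computable x0 -> computable x1 ->
  computable (fun a => orthogonal_family (x0 a) (x1 a)).
Proof.
move=> h0 h1; suff H : computable (fun p : nat * (seq (seq gint)) => orthogonal_family p.1 p.2).
  exact: (comp_ap H (comp_pair h0 h1)).
by rewrite /orthogonal_family; comp_tac.
Qed.

Lemma comp_proj_frac (A : countType) (x0 : A -> seq (seq gint)) (x1 : A -> nat) (x2 : A -> nat) :
  computable x0 -> computable x1 -> computable x2 ->
  computable (fun a => proj_frac (x0 a) (x1 a) (x2 a)).
Proof.
move=> h0 h1 h2; suff H : computable (fun p : (seq (seq gint)) * nat * nat => proj_frac p.1.1 p.1.2 p.2).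
  exact: (comp_ap H (comp_pair (comp_pair h0 h1) h2)).
by rewrite /proj_frac; comp_tac.
Qed.

Lemma comp_entry_lip (A : countType) (x0 : A -> ecode) :
  computable x0 ->
  computable (fun a => entry_lip (x0 a)).
Proof.
move=> h0; suff H : computable (fun p : ecode => entry_lip p).
  exact: (comp_ap H h0).
by rewrite /entry_lip; comp_tac.
Qed.

Lemma comp_grid_near (A : countType) (x0 : A -> ecode) (x1 : A -> gint * int) (x2 : A -> nat) (x3 : A -> nat) (x4 : A -> gint) :
  computable x0 -> computable x1 -> computable x2 -> computable x3 -> computable x4 ->
  computable (fun a => grid_near (x0 a) (x1 a) (x2 a) (x3 a) (x4 a)).
Proof.
move=> h0 h1 h2 h3 h4; suff H : computable (fun p : ecode * (gint * int) * nat * nat * gint => grid_near p.1.1.1.1 p.1.1.1.2 p.1.1.2 p.1.2 p.2).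
  exact: (comp_ap H (comp_pair (comp_pair (comp_pair (comp_pair h0 h1) h2) h3) h4)).
by rewrite /grid_near; comp_tac.
Qed.

Lemma comp_unit_entry (A : countType) (x0 : A -> int) (x1 : A -> gint) :
  computable x0 -> computable x1 ->
  computable (fun a => unit_entry (x0 a) (x1 a)).
Proof.
move=> h0 h1; suff H : computable (fun p : int * gint => unit_entry p.1 p.2).
  exact: (comp_ap H (comp_pair h0 h1)).
by rewrite /unit_entry; comp_tac.
Qed.

Ltac comp_frac := lazymatch goal with
  | |- computable (fun e => orthogonal_family (@?x0 e) (@?x1 e)) => apply (@comp_orthogonal_family _ x0 x1)
  | |- computable (fun e => proj_frac (@?x0 e) (@?x1 e) (@?x2 e)) => apply (@comp_proj_frac _ x0 x1 x2)
  | |- computable (fun e => entry_lip (@?x0 e)) => apply (@comp_entry_lip _ x0)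
  | |- computable (fun e => grid_near (@?x0 e) (@?x1 e) (@?x2 e) (@?x3 e) (@?x4 e)) => apply (@comp_grid_near _ x0 x1 x2 x3 x4)
  | |- computable (fun e => unit_entry (@?x0 e) (@?x1 e)) => apply (@comp_unit_entry _ x0 x1)
  end.
Ltac comp_user ::= first [comp_gauss | comp_grid | comp_frac].

Lemma comp_grid_far (A : countType) (x0 : A -> ecode) (x1 : A -> nat) (x2 : A -> gint) :
  computable x0 -> computable x1 -> computable x2 ->
  computable (fun a => grid_far (x0 a) (x1 a) (x2 a)).
Proof.
move=> h0 h1 h2; suff H : computable (fun p : ecode * nat * gint => grid_far p.1.1 p.1.2 p.2).
  exact: (comp_ap H (comp_pair (comp_pair h0 h1) h2)).
by rewrite /grid_far; comp_tac.
Qed.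

Lemma comp_unit_family (A : countType) (x0 : A -> seq (seq gint)) :
  computable x0 ->
  computable (fun a => unit_family (x0 a)).
Proof.
move=> h0; suff H : computable (fun p : (seq (seq gint)) => unit_family p).
  exact: (comp_ap H h0).
by rewrite /unit_family; comp_tac.
Qed.

Ltac comp_far := lazymatch goal with
  | |- computable (fun e => grid_far (@?x0 e) (@?x1 e) (@?x2 e)) => apply (@comp_grid_far _ x0 x1 x2)
  | |- computable (fun e => unit_family (@?x0 e)) => apply (@comp_unit_family _ x0)
  end.
Ltac comp_user ::= first [comp_gauss | comp_grid | comp_frac | comp_far].

Lemma comp_entry_test (A : countType) (x0 : A -> ecode) (x1 : A -> gint * int) (x2 : A -> nat) (x3 : A -> nat) :
  computable x0 -> computable x1 -> computable x2 -> computable x3 ->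
  computable (fun a => entry_test (x0 a) (x1 a) (x2 a) (x3 a)).
Proof.
move=> h0 h1 h2 h3; suff H : computable (fun p : ecode * (gint * int) * nat * nat => entry_test p.1.1.1 p.1.1.2 p.1.2 p.2).
  exact: (comp_ap H (comp_pair (comp_pair (comp_pair h0 h1) h2) h3)).
by rewrite /entry_test; comp_tac.
Qed.

(** * A prefix-free machine listing computable levels *)

(** [str_code] is undone by repeatedly subtracting 1 and splitting off the parity. The bits come out
    in reverse order, and [c] rounds are enough because a string is no longer than its code. *)
Definition str_decode (c : nat) : seq bool :=
  foldl (fun t x => x :: t) [::]
    (iter c (fun st : nat * seq bool =>
       if st.1 == 0%N then st else ((st.1 - 1)./2, odd (st.1 - 1) :: st.2)) (c, [::])).2.

Lemma size_str_code s : (size s <= str_code s)%N.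
Proof. by elim: s => //= b s IH; lia. Qed.

Lemma str_codeK s : str_decode (str_code s) = s.
Proof.
rewrite /str_decode; set step := fun _ : nat * _ => _.
have H n r t : (size r <= n)%N -> iter n step (str_code r, t) = (0%N, catrev r t).
  elim: n r t => [|n IH] [|x r] t hn //; rewrite iterSr; first exact: (IH [::]).
  suff -> : step (str_code (x :: r), t) = (str_code r, x :: t) by apply: IH.
  rewrite /step /= subn1 /= oddD odd_double oddb; congr (_, _).
  by case: x {hn} => /=; rewrite ?addn1 ?addn0 /= ?uphalf_double ?doubleK.
rewrite H ?size_str_code // -[(_, _).2]/(rev s).
suff E (r u : seq bool) : foldl (fun t x => x :: t) u r = rev r ++ u by rewrite E cats0 revK.
by elim: r u => //= x r IH u; rewrite IH rev_cons cat_rcons.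
Qed.

Lemma comp_str_decode : computable str_decode.
Proof.
by rewrite /str_decode; apply: (@comp_foldl nat bool (seq bool) (fun _ t x => x :: t)); comp_tac.
Qed.

Definition lead_ones (s : seq bool) : nat := foldr (fun (b : bool) n => if b then n.+1 else 0%N) 0%N s.
Definition payload (s : seq bool) : seq bool := drop (lead_ones s).+1 s.
Definition bits_val (s : seq bool) : nat := foldr (fun (b : bool) n => b + 2 * n)%N 0%N s.
Fixpoint bits (l t : nat) : seq bool := if l is l'.+1 then odd t :: bits l' t./2 else [::].

Lemma size_bits l t : size (bits l t) = l.
Proof. by elim: l t => //= l IH t; rewrite IH. Qed.

Lemma bitsK l t : (t < 2 ^ l)%N -> bits_val (bits l t) = t.
Proof.
elim: l t => [|l IH] t /=; first by rewrite expn0; case: t.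
rewrite expnS => ht; rewrite IH; first by rewrite mul2n odd_double_half.
by move: ht (odd_double_half t); move: (2 ^ l)%N => z; case: odd; lia.
Qed.

Lemma lead_ones_block q s : lead_ones (nseq q true ++ false :: s) = q.
Proof. by elim: q => //= q ->. Qed.

Lemma payload_block q s : payload (nseq q true ++ false :: s) = s.
Proof.
rewrite /payload lead_ones_block drop_cat size_nseq ltnNge leqnSn /=.
by rewrite subSn // subnn /= drop0.
Qed.

(** A nonempty payload means that the 0 ending the initial block of ones already lies in [s]. *)
Lemma lead_ones_cat s t : (0 < size (payload s))%N -> lead_ones (s ++ t) = lead_ones s.
Proof.
rewrite /payload size_drop subn_gt0; elim: s => //= -[] //= s IH; rewrite ltnS => h.
by rewrite IH.
Qed.

Section PrefixMachine.
Variables (T : countType) (lev : nat -> nat -> bool) (out : nat -> T) (a b : nat).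
Hypothesis b_gt0 : (0 < b)%N.
Hypothesis lev_comp : computable (fun p : nat * nat => lev p.1 p.2).
Hypothesis out_comp : computable out.

Definition block_valid (s : seq bool) := size (payload s) == (a * lead_ones s + b)%N.

(** The payload is the rank of [m] in the level given by the leading ones. *)
Definition block_match (m c : nat) : bool :=
  [&& block_valid (str_decode c), lev (lead_ones (str_decode c)) m &
      count (lev (lead_ones (str_decode c))) (iota 0 m) == bits_val (payload (str_decode c))].

Lemma comp_block_match : computable (fun p : nat * nat => block_match p.1 p.2).
Proof.
have hd : computable (fun p : nat * nat => (p.1, str_decode p.2)).
  by comp_tac; apply: (comp_ap comp_str_decode); comp_tac.
suff H : computable (fun p : nat * seq bool => [&& block_valid p.2, lev (lead_ones p.2) p.1 &
    count (lev (lead_ones p.2)) (iota 0 p.1) == bits_val (payload p.2)]).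
  exact: (comp_ap H hd).
have hl : computable lead_ones by rewrite /lead_ones; comp_tac.
have hp : computable payload by rewrite /payload; comp_tac.
have hv : computable bits_val by rewrite /bits_val; comp_tac.
have h2 : computable (fun p : nat * seq bool => lead_ones p.2) by apply: (comp_ap hl); comp_tac.
have h3 : computable (fun p : nat * seq bool => payload p.2) by apply: (comp_ap hp); comp_tac.
rewrite /block_valid; comp_tac => //.
- exact: (comp_ap lev_comp (comp_pair h2 (comp_fst (comp_id _)))).
- apply: (comp_ap lev_comp (f := fun p : (nat * seq bool) * nat => (lead_ones p.1.2, p.2))); comp_tac.
  by apply: (comp_ap hl); comp_tac.
- exact: (comp_ap hv h3).
Qed.

(** Two members of one level have different ranks, because the smaller one is counted before the
    larger. *)
Lemma block_match_inj m m' s : block_match m (str_code s) -> block_match m' (str_code s) -> m = m'.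
Proof.
rewrite /block_match str_codeK => /and3P[_ h1 /eqP e1] /and3P[_ h2 /eqP e2].
wlog lt : m m' h1 h2 e1 e2 / (m < m')%N => [W|].
  by case: (ltngtP m m') => // lt; [apply: W|apply/esym; apply: W].
move: e2; rewrite -e1 -(subnKC lt) addSn -addnS [in LHS]iotaD count_cat add0n => /eqP.
by rewrite -[X in _ == X]addn0 eqn_add2l /= h1.
Qed.

(** The machine searches for the index matching its input and outputs the code attached to it. An
    input on which it halts has its length determined by its leading ones, whence
    prefix-freeness. *)
Lemma prefix_machine : exists2 M, pf_machine M &
  forall q m, lev q m -> (count (lev q) (iota 0 m) < 2 ^ (a * q + b))%N ->
  exists2 sigma, size sigma = (q.+1 + (a * q + b))%N & M sigma = Some (pickle (out m)).
Proof.
have [F [pF hF] eF] := comp_block_match; have [G [pO hO] eO] := out_comp.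
have [pc hpc] : recf 2 (fun v => 1 - F (CodeSeq.code [:: nth 0 v 0; nth 0 v 1]))%N.
  apply: (recf_ap2 recf2_sub); first exact: recf_const.
  apply: (@recf_ap1 2 F); first by exists pF.
  apply: (recf_ap2 recf2_cons); first exact: recf_nth.
  by apply: (recf_ap2 recf2_cons); [apply: recf_nth|apply: recf_const].
have {}hpc m c : prf_conv pc [:: m; c] (~~ block_match m c).
  by have := hpc [:: m; c] erefl; rewrite (eF (m, c)) /=; case: block_match.
pose P := PComp pO [:: PMu pc].
have hP c y : prf_conv P [:: c] y -> exists2 m, block_match m c & y = pickle (out m).
  move=> [[//|n]]; rewrite prf_evalE_comp /prf_evals.
  case E: prf_eval => [m|//] hy; exists m.
    have hm : prf_conv (PMu pc) [:: c] m by exists n.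
    have [+ _] := prf_mu_conv (hpc^~ c) hm.
    by case: block_match.
  have h1 : prf_conv pO [:: m] y by exists n.
  by rewrite -(eO m); apply: (prf_conv_fun h1); apply: (hO [:: m]).
have hP' m c : block_match m c -> (forall m', block_match m' c -> m' = m) ->
    prf_conv P [:: c] (pickle (out m)).
  move=> hm um; apply: (@prf_conv_comp _ _ _ [:: PMu pc] [:: m]) => // [[|//] _|].
    apply: (prf_conv_mu (f := fun i => ~~ block_match i c : nat)) => [i||i hi] /=.
    - exact: hpc.
    - by rewrite hm.
    - by case E: block_match => //; rewrite (um i E) ltnn in hi.
  by rewrite -(eO m); apply: (hO [:: m]).
(* Halting is undecidable, so [M] is defined classically from the convergence of [P]; that [P]
   computes it is then immediate. *)
pose M (s : seq bool) : option nat :=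
  if pselect (exists y, prf_conv P [:: str_code s] y) is left h then Some (projT1 (cid h)) else None.
have MP s y : M s = Some y <-> prf_conv P [:: str_code s] y.
  rewrite /M; case: pselect => [h|h]; last by split=> // hy; case: h; exists y.
  case: (cid h) => z hz /=; split=> [[<-]//|hy]; congr Some; exact: prf_conv_fun hz hy.
have Mv s : M s <> None -> block_valid s.
  case E: (M s) => [y|//] _; move/MP: E => /hP[m + _].
  by rewrite /block_match str_codeK => /andP[].
exists M; first split.
- by exists P.
(* Here [0 < b] matters: the payload of [s] is nonempty, so [s] and [s ++ t] have the same leading
   ones and hence the same length. *)
- move=> s t /Mv vs /Mv vt; move: vt; rewrite /block_valid /payload lead_ones_cat; last first.
    by rewrite (eqP vs) addn_gt0 b_gt0 orbT.
  move: vs; rewrite /block_valid /payload => /eqP vs /eqP.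
  move: vs; rewrite !size_drop size_cat => vs vt; apply/eqP; rewrite -size_eq0; apply/eqP.
  have key (x y w z : nat) : (0 < b -> x - w.+1 = z + b -> x + y - w.+1 = z + b -> y = 0)%N by lia.
  exact: key b_gt0 vs vt.
- move=> q m hm hc; pose s := nseq q true ++ false :: bits (a * q + b) (count (lev q) (iota 0 m)).
  exists s; first by rewrite size_cat size_nseq /= size_bits addSnnS.
  apply/MP; have hs : block_match m (str_code s).
    rewrite /block_match str_codeK /block_valid /s lead_ones_block payload_block size_bits hm.
    by rewrite bitsK // !eqxx.
  by apply: (hP' _ _ hs) => m' hm'; apply: block_match_inj hm' hs.
Qed.
End PrefixMachine.

(** * Soundness and completeness of the approximation test *)

Local Notation normc := ComplexField.Normc.normc.

Section ComplexNorm.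
Variable R : realType.
Local Notation C := R[i].
Implicit Types z w : C.

Lemma sqr_normcE z : normc z ^+ 2 = complex.Re z ^+ 2 + complex.Im z ^+ 2.
Proof. by case: z => a b; rewrite sqr_sqrtr //= addr_ge0 ?sqr_ge0. Qed.

Lemma normc_ge0 z : 0 <= normc z.
Proof. by case: z => a b; apply: sqrtr_ge0. Qed.

Lemma normc_eq0 z : (normc z == 0) = (z == 0).
Proof. by apply/eqP/eqP => [/ComplexField.Normc.eq0_normc //|->]; apply: ComplexField.Normc.normc0. Qed.

Lemma normc_normE z : `|z| = (normc z)%:C%C.
Proof. by []. Qed.

Lemma normc_le_add z : normc z <= `|complex.Re z| + `|complex.Im z|.
Proof.
rewrite -(@ler_pXn2r _ 2) ?nnegrE ?addr_ge0 ?normc_ge0 // sqr_normcE sqrrD !real_normK ?num_real //.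
by have := mulr_ge0 (normr_ge0 (complex.Re z)) (normr_ge0 (complex.Im z)); lra.
Qed.

Lemma normc_ReB z : `|complex.Re z| <= normc z.
Proof.
rewrite -(@ler_pXn2r _ 2) ?nnegrE ?normc_ge0 // sqr_normcE real_normK ?num_real //.
by rewrite lerDl sqr_ge0.
Qed.

Lemma normc_ImB z : `|complex.Im z| <= normc z.
Proof.
rewrite -(@ler_pXn2r _ 2) ?nnegrE ?normc_ge0 // sqr_normcE real_normK ?num_real //.
by rewrite lerDr sqr_ge0.
Qed.

Lemma normc_triangle z w : normc (z + w) <= normc z + normc w.
Proof. exact: le_normcD. Qed.

Lemma normcB z w : normc (z - w) = normc (w - z).
Proof. by rewrite -normcN opprB. Qed.

Lemma normc_dist z w x : normc (z - x) <= normc (z - w) + normc (w - x).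
Proof. by have := normc_triangle (z - w) (w - x); rewrite addrA subrK. Qed.

Lemma normc_conj z : normc (conjc z) = normc z.
Proof. by case: z => a b /=; rewrite sqrrN. Qed.

Lemma mul_conjc z : z * conjc z = ((normc z) ^+ 2)%:C%C.
Proof. by rewrite rmorphXn /= -normc_normE sqr_normc. Qed.

Lemma normc_real (x : R) : normc (x%:C%C) = `|x|.
Proof. by rewrite /= expr0n /= addr0 sqrtr_sqr. Qed.

Lemma normc_int (n : int) : normc (n%:~R : C) = `|n%:~R|.
Proof. by rewrite -(rmorph_int (real_complex R)) normc_real. Qed.

Lemma normc_sum (I : Type) (r : seq I) (P : pred I) (F : I -> C) :
  normc (\sum_(i <- r | P i) F i) <= \sum_(i <- r | P i) normc (F i).
Proof.
elim/big_ind2: _ => [||//]; first by rewrite ComplexField.Normc.normc0.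
by move=> x1 x2 y1 y2 h1 h2; apply: (le_trans (normc_triangle _ _)); apply: lerD.
Qed.

End ComplexNorm.

#[local] Arguments ComplexField.Normc.normc : simpl never.

Section GaussValue.
Variable R : realType.
Local Notation C := R[i].

Definition gval (x : int * int) : C := Complex (x.1%:~R) (x.2%:~R).

Lemma gvalD x y : gval (gadd x y) = gval x + gval y.
Proof. by rewrite /gval /= !rmorphD. Qed.
Lemma gvalM x y : gval (gmul x y) = gval x * gval y.
Proof. by rewrite /gval /= rmorphB rmorphD !rmorphM. Qed.
Lemma gvalJ x : gval (gconj x) = conjc (gval x).
Proof. by rewrite /gval /= rmorphN. Qed.
Lemma gval_int (c : int) : gval (c, 0) = c%:~R.
Proof. by rewrite -(rmorph_int (real_complex R)). Qed.
Lemma gvalZ c x : gval (gscale c x) = c%:~R * gval x.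
Proof.
by rewrite -gval_int -gvalM; congr gval; rewrite /gmul /gscale /= !mul0r subr0 addr0.
Qed.
Lemma gval_norm x : normc (gval x) ^+ 2 = (gnorm2 x)%:~R.
Proof. by rewrite sqr_normcE /gnorm2 rmorphD /= !rmorphM !expr2. Qed.

Lemma gval_eq0 x : (x.1 == 0) && (x.2 == 0) = (gval x == 0).
Proof. by rewrite eq_complex /= !intr_eq0. Qed.

Lemma foldr_iota_sum n (F : nat -> int * int) :
  gval (foldr (fun i acc => gadd (F i) acc) (0, 0) (iota 0 n)) = \sum_(i < n) gval (F i).
Proof.
rewrite -(big_mkord xpredT (fun i => gval (F i))) /index_iota subn0.
by elim: (iota 0 n) => [|i s IH]; rewrite ?big_nil // big_cons /= gvalD IH.
Qed.

Lemma gval_inner u v : gval (ginner u v) =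
  \sum_(i < size u) conjc (gval (gnth u i)) * gval (gnth v i).
Proof.
rewrite /ginner (foldr_iota_sum _ (fun i => gmul (gconj (gnth u i)) (gnth v i))).
by apply: eq_bigr => i _; rewrite gvalM gvalJ.
Qed.

Lemma gsqnormE u : (gsqnorm u)%:~R = \sum_(i < size u) normc (gval (gnth u i)) ^+ 2 :> R.
Proof.
transitivity (\sum_(x <- u) normc (gval x) ^+ 2); last by rewrite (big_nth (0, 0)) big_mkord.
rewrite /gsqnorm.
elim: u => [|x u IH] /=; first by rewrite big_nil.
by rewrite big_cons rmorphD /= IH gval_norm.
Qed.

Lemma gsqnorm_inner u : ((gsqnorm u)%:~R : C) = gval (ginner u u).
Proof.
rewrite gval_inner -(rmorph_int (real_complex R)) gsqnormE rmorph_sum.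
by apply: eq_bigr => i _; rewrite mulrC mul_conjc.
Qed.

Definition proj_entry (us : seq (seq (int * int))) (i j : nat) : C :=
  \sum_(u <- us) gval (gnth u i) * conjc (gval (gnth u j)) / (gsqnorm u)%:~R.

Lemma proj_fracE us i j : all (fun u => 0 < gsqnorm u) us ->
  0 < (proj_frac us i j).2 /\
  gval (proj_frac us i j).1 = (proj_frac us i j).2%:~R * proj_entry us i j.
Proof.
elim: us => [|u us IH] /=; first by split=> //; rewrite /proj_entry big_nil mulr0.
move=> /andP[hu /IH [h1 h2]]; split; first exact: mulr_gt0.
rewrite gvalD !gvalZ h2 gvalM gvalJ /proj_entry big_cons rmorphM /=.
have : ((gsqnorm u)%:~R : C) != 0 by rewrite intr_eq0 gt_eqF.
by move: (_%:~R) (\sum_(_ <- _) _) => x y; set p := _%:~R => hx; field.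
Qed.

Definition int_eval (cs : seq int) (z : C) : C := foldr (fun c acc => c%:~R + z * acc) 0 cs.

Lemma entry_polyE (e : entry_code) z : (entry_poly R e).[z] = int_eval e.1 z.
Proof.
rewrite /entry_poly /int_eval; elim: e.1 => [|c cs IH] /=; first by rewrite rmorph0 horner0.
rewrite cons_poly_def rmorphD rmorphM /= map_polyX map_polyC hornerD hornerM hornerX hornerC IH.
by rewrite addrC mulrC.
Qed.

Lemma int_eval_bound M cs z : normc z <= M%:R -> normc (int_eval cs z) <= (poly_bounds M cs).1%:R.
Proof.
move=> hz; elim: cs => [|c cs IH] /=; first by rewrite ComplexField.Normc.normc0.
apply: le_trans (normc_triangle _ _) _; rewrite natrD natrM ComplexField.Normc.normcM normc_int.
by apply: lerD; [rewrite natr_absz intr_norm|apply: ler_pM; rewrite ?normc_ge0].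
Qed.

Lemma int_eval_lip M cs z w : normc z <= M%:R -> normc w <= M%:R ->
  normc (int_eval cs z - int_eval cs w) <= (poly_bounds M cs).2%:R * normc (z - w).
Proof.
move=> hz hw; elim: cs => [|c cs IH] /=; first by rewrite subrr ComplexField.Normc.normc0 mul0r.
have -> : c%:~R + z * int_eval cs z - (c%:~R + w * int_eval cs w) =
    z * (int_eval cs z - int_eval cs w) + (z - w) * int_eval cs w by ring.
apply: le_trans (normc_triangle _ _) _; rewrite !ComplexField.Normc.normcM natrD natrM mulrDl.
apply: lerD; last by rewrite mulrC; apply: ler_wpM2r; [exact: normc_ge0|exact: int_eval_bound].
by rewrite -mulrA; apply: ler_pM; rewrite ?normc_ge0.
Qed.

Lemma horner_homE cs W (Q : int) : Q != 0 ->
  (horner_hom cs W Q).2 = Q ^+ size cs /\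
  gval (horner_hom cs W Q).1 = (horner_hom cs W Q).2%:~R * int_eval cs (gval W / Q%:~R).
Proof.
move=> Q0; elim: cs => [|c cs [h1 h2]] /=; first by rewrite mulr0.
split; first by rewrite h1 exprSr.
rewrite gvalD gval_int gvalM h2 !rmorphM /=.
have : (Q%:~R : C) != 0 by rewrite intr_eq0.
by rewrite -/(int_eval cs _); set q := Q%:~R; move: (int_eval _ _) => x hq; field.
Qed.

End GaussValue.

Section EntryTest.
Variable R : realType.
Local Notation C := R[i].

Lemma ratrE (q : rat) : ratr q = (numq q)%:~R / (denq q)%:~R :> R.
Proof. by []. Qed.

Lemma ratr_le_numq (q : rat) : `|ratr q : R| <= `|numq q|%N%:R.
Proof.
rewrite ratrE normrM normfV -!intr_norm natr_absz ler_pdivrMr; last first.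
  by rewrite ltr0z normr_gt0 denq_neq0.
by rewrite ler_peMr ?ler0z // ler1z gtr0_norm ?denq_gt0 //; have := denq_gt0 q; lia.
Qed.

Lemma divc_real (x y q : R) : Complex x y / q%:C%C = Complex (x / q) (y / q).
Proof. by rewrite -fmorphV /=; simpc. Qed.

Lemma ltr_sqr_ge0 (x y : R) : 0 <= x -> 0 <= y -> (x ^+ 2 < y ^+ 2) = (x < y).
Proof. by move=> hx hy; rewrite ltr_pXn2r. Qed.
Lemma ler_sqr_ge0 (x y : R) : 0 <= x -> 0 <= y -> (x ^+ 2 <= y ^+ 2) = (x <= y).
Proof. by move=> hx hy; rewrite ler_pXn2r. Qed.

Definition grid_point (e : entry_code) (N i j : nat) : C :=
  gval R (grid_num e N i j) / (grid_den e N)%:~R.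

Lemma grid_den_gt0 (e : entry_code) N : (0 < N)%N -> 0 < grid_den e N.
Proof. by move=> N0; rewrite /grid_den !mulr_gt0 ?denq_gt0. Qed.

Lemma grid_pointE (e : entry_code) N i j : (0 < N)%N -> (i <= N)%N -> (j <= N)%N ->
  grid_point e N i j =
    Complex (ratr e.2.1.1.1 + (ratr e.2.1.1.2 - ratr e.2.1.1.1) * (i%:R / N%:R))
            (ratr e.2.1.2 + (ratr e.2.2 - ratr e.2.1.2) * (j%:R / N%:R)).
Proof.
move=> N0 iN jN; rewrite /grid_point -(rmorph_int (real_complex R)) divc_real.
case: e => cs [[[a b] c] d] /=.
rewrite !ratrE /grid_den /grid_num /=.
rewrite !(rmorphM, rmorphD) /= -!pmulrn !natrB //.
have := denq_neq0 a; have := denq_neq0 b; have := denq_neq0 c; have := denq_neq0 d.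
rewrite -!(intr_eq0 R); move: N0; rewrite -(ltr0n R) => /lt0r_neq0 h0 hd hc hb ha.
by congr Complex; field; rewrite ?h0 ?ha ?hb ?hc ?hd.
Qed.

(** In each coordinate the index is the integer part of [N (x - A) / (B - A)], with an error of at
    most one mesh width. *)
Lemma grid_pointP (e : entry_code) (N : nat) (z : C) : (0 < N)%N -> in_box e z ->
  exists i j, [/\ (i <= N)%N, (j <= N)%N &
    normc (z - grid_point e N i j) <= (2 * box_bound e)%:R / N%:R].
Proof.
have near (A B x : R) : (0 < N)%N -> A <= x <= B ->
    exists2 i, (i <= N)%N & `|x - (A + (B - A) * (i%:R / N%:R))| <= (`|A| + `|B|) / N%:R.
  move=> N0 /andP[hA hB]; have N0' : 0 < N%:R :> R by rewrite ltr0n.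
  pose t := N%:R * ((x - A) / (B - A)).
  (* A side of length zero would make the quotient meaningless; its only point is the grid point of
     index 0. *)
  have [AB|AB] := eqVneq A B.
    exists 0%N => //; have -> : x = A by apply/eqP; rewrite eq_le hA AB hB.
    by rewrite mul0r mulr0 addr0 subrr normr0 divr_ge0 ?addr_ge0 // ltW.
  have BA : 0 < B - A by rewrite subr_gt0 lt_neqAle AB (le_trans hA).
  have AB' : A <= B := le_trans hA hB.
  have t0 : 0 <= t by rewrite mulr_ge0 ?divr_ge0 ?subr_ge0.
  have tN : t <= N%:R.
    by rewrite /t ler_piMr ?(ltW N0') // ler_pdivrMr // mul1r lerD2r.
  have /andP[h1 h2] := Num.Theory.truncn_itv t0.
  exists (Num.truncn t); first by rewrite -(ler_nat R) (le_trans h1).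
  have -> : x - (A + (B - A) * ((Num.truncn t)%:R / N%:R)) = (B - A) / N%:R * (t - (Num.truncn t)%:R).
    by rewrite /t; field; rewrite !gt_eqF.
  rewrite normrM ger0_norm; last by rewrite divr_ge0 // ltW.
  rewrite ger0_norm ?subr_ge0 //; apply: (@le_trans _ _ ((B - A) / N%:R)).
    rewrite ler_piMr ?divr_ge0 ?(ltW BA) ?(ltW N0') //.
    by move: h2; rewrite -natr1; lra.
  rewrite ler_pM2r ?invr_gt0 //; have := ler_norm B.
  by have := ler_norm (- A); rewrite normrN; lra.
move=> N0; case: e => cs [[[a b] c] d]; rewrite /in_box /= => /andP[h1 h2].
have [i hi hi'] := near _ _ _ N0 h1; have [j hj hj'] := near _ _ _ N0 h2.
exists i, j; split=> //; apply: le_trans (normc_le_add _) _.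
rewrite grid_pointE //; case: z h1 h2 hi' hj' => x y h1 h2 hi' hj' /=.
apply: le_trans (lerD hi' hj') _; rewrite -mulrDl ler_pM2r ?invr_gt0 ?ltr0n //.
have := ratr_le_numq a; have := ratr_le_numq b; have := ratr_le_numq c; have := ratr_le_numq d.
rewrite /box_bound /= natrM -(addn1 (_ + _)) !natrD.
have := ler0n R `|numq a|; have := ler0n R `|numq b|; have := ler0n R `|numq c|; have := ler0n R `|numq d|.
by lra.
Qed.

Lemma in_box_bound (e : entry_code) (z : C) : in_box e z -> normc z <= (box_bound e)%:R.
Proof.
case: e z => cs [[[a b] c] d] [x y]; rewrite /in_box /= => /andP[/andP[h1 h2] /andP[h3 h4]].
apply: le_trans (normc_le_add _) _ => /=; rewrite /box_bound /= -(addn1 (_ + _)) !natrD.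
have := ratr_le_numq a; have := ratr_le_numq b; have := ratr_le_numq c; have := ratr_le_numq d.
have bd (A B u : R) : A <= u -> u <= B -> `|u| <= `|A| + `|B|.
  move=> hA hB; rewrite ler_norml; have := ler_norm (- A); have := ler_norm B; rewrite normrN.
  by have := normr_ge0 A; have := normr_ge0 B; lra.
by have := bd _ _ _ h1 h2; have := bd _ _ _ h3 h4; lra.
Qed.

Lemma grid_point_in_box (e : entry_code) N i j (z : C) : in_box e z -> (0 < N)%N -> (i <= N)%N -> (j <= N)%N ->
  in_box e (grid_point e N i j).
Proof.
move=> hz N0 iN jN; rewrite grid_pointE //; case: e hz => cs [[[a b] c] d]; rewrite /in_box /=.
move=> /andP[/andP[h1 h2] /andP[h3 h4]].
have hf (A B : R) (k : nat) : (k <= N)%N -> A <= B -> A <= A + (B - A) * (k%:R / N%:R) <= B.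
  move=> kN AB; have N0' : 0 < N%:R :> R by rewrite ltr0n.
  have k0 : 0 <= k%:R / N%:R :> R by rewrite divr_ge0.
  have k1 : k%:R / N%:R <= 1 :> R by rewrite ler_pdivrMr // mul1r ler_nat.
  by move: (k%:R / N%:R) k0 k1 => t t0 t1; nra.
by rewrite !hf // ?(le_trans h1) ?(le_trans h3).
Qed.

Lemma grid_farE (e : entry_code) N i j : (0 < N)%N ->
  grid_far e N (grid_num e N i j) =
  ((entry_lip e)%:R < normc (int_eval e.1 (grid_point e N i j)) * N%:R).
Proof.
move=> N0; have Q0 := grid_den_gt0 e N0.
have [h1 h2] := horner_homE R e.1 (grid_num e N i j) (lt0r_neq0 Q0).
rewrite /grid_far -(ltr_int R) !rmorphM /= -gval_norm h2 -!pmulrn ComplexField.Normc.normcM.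
rewrite normc_int -/(grid_point e N i j); set p := normc (int_eval _ _).
have P0 : 0 < `|((horner_hom e.1 (grid_num e N i j) (grid_den e N)).2)%:~R : R|.
  by rewrite normr_gt0 intr_eq0 h1 expf_neq0 // lt0r_neq0.
set H := (_%:~R : R) in P0 *.
have -> : (entry_lip e)%:R * (entry_lip e)%:R * (H * H) = ((entry_lip e)%:R * `|H|) ^+ 2.
  by rewrite exprMn real_normK ?num_real // !expr2.
have -> : (`|H| * p) ^+ 2 * (N%:R * N%:R) = (p * N%:R * `|H|) ^+ 2 by ring.
by rewrite ltr_sqr_ge0 ?mulr_ge0 ?normc_ge0 ?normr_ge0 // ltr_pM2r.
Qed.

Lemma grid_nearE (e : entry_code) (P : int * int * int) T N i j : (0 < N)%N -> 0 < P.2 ->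
  grid_near e P T N (grid_num e N i j) =
  (normc (grid_point e N i j - gval R P.1 / P.2%:~R) * (2 * T)%:R <= 1).
Proof.
move=> N0 P0; have := grid_den_gt0 e N0; rewrite /grid_near /grid_point.
move: (grid_den e N) (grid_num e N i j) => Q W Q0.
rewrite -(ler_int R) !rmorphM /= -gval_norm gvalD !gvalZ -!pmulrn.
set q := Q%:~R : R; set p := P.2%:~R : R.
have qp : 0 < q * p by rewrite mulr_gt0 ?ltr0z.
have -> : P.2%:~R * gval R W + (- Q)%:~R * gval R P.1 =
    (q * p)%:C%C * (gval R W / Q%:~R - gval R P.1 / P.2%:~R).
  rewrite rmorphM /= !rmorph_int rmorphN /=.
  have : (Q%:~R : C) != 0 by rewrite intr_eq0 gt_eqF.
  have : (P.2%:~R : C) != 0 by rewrite intr_eq0 gt_eqF.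
  by move: (gval R P.1) (gval R W) => u v hp hq; field; rewrite hp.
rewrite ComplexField.Normc.normcM normc_real gtr0_norm //.
set x := normc _.
have -> : (q * p * x) ^+ 2 * ((2 * T)%:R * (2 * T)%:R) = (q * p * (x * (2 * T)%:R)) ^+ 2 by ring.
have xT : 0 <= x * (2 * T)%:R by rewrite mulr_ge0 ?normc_ge0.
by rewrite -expr2 (ler_sqr_ge0 (mulr_ge0 (ltW qp) xT) (ltW qp)) -{2}[q * p]mulr1 ler_pM2l.
Qed.

(** Let [w] be a grid point next to the root [z]. By the Lipschitz bound the polynomial is at most
    [entry_lip e / N] at [w], so [w] is not far and must be near [P]; the triangle inequality
    through [w] concludes. *)
Lemma entry_test_sound (e : entry_code) (z : C) (P : int * int * int) T N :
  entry_denotes e z -> (0 < T)%N -> 0 < P.2 -> entry_test e P T N ->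
  normc (z - gval R P.1 / P.2%:~R) <= T%:R^-1.
Proof.
rewrite /entry_test => -[_ [rz [bz _]]] T0 P0 /andP[hN /allP H].
have N0 : (0 < N)%N by lia.
have [i [j [iN jN hij]]] := grid_pointP N0 bz.
have inI k : (k <= N)%N -> k \in iota 0 N.+1 by rewrite mem_iota.
have /allP/(_ j (inI j jN)) := H i (inI i iN).
rewrite grid_farE // grid_nearE //; set w := grid_point _ _ _ _ in hij *.
have N0' : 0 < N%:R :> R by rewrite ltr0n.
have T0' : 0 < T%:R :> R by rewrite ltr0n.
move=> /orP[far|near].
  have bw : in_box e w by apply: grid_point_in_box bz _ _ _.
  have := int_eval_lip e.1 (in_box_bound bw) (in_box_bound bz).
  move/rootP: rz; rewrite entry_polyE => ->; rewrite subr0 normcB => hl.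
  have /lt_le_trans : (entry_lip e)%:R < normc (int_eval e.1 w) * N%:R := far.
  move=> /(_ (entry_lip e)%:R); rewrite ltxx => F; exfalso.
  suff /F : normc (int_eval e.1 w) * N%:R <= (entry_lip e)%:R by [].
  rewrite -ler_pdivlMr //; apply: le_trans hl _; rewrite /entry_lip natrM.
  by rewrite [X in _ <= X / _]mulrC -mulrA; apply: ler_wpM2l.
apply: le_trans (normc_dist _ w _) _.
(* The condition [4 * box_bound e * T < N] of the test is exactly what puts the mesh error below
   [1 / (2 T)]. *)
have h1 : (2 * box_bound e)%:R / N%:R <= (2 * T)%:R^-1 :> R.
  rewrite ler_pdivrMr // ler_pdivlMl ?ltr0n ?muln_gt0 //.
  by rewrite -natrM ler_nat; move: hN; lia.
have h2 : normc (w - gval R P.1 / P.2%:~R) <= (2 * T)%:R^-1.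
  by rewrite -[X in _ <= X]mul1r ler_pdivlMr // ltr0n muln_gt0.
apply: le_trans (lerD (le_trans hij h1) h2) _.
by rewrite natrM invfM; have := invr_gt0 (T%:R : R); rewrite T0' => h; lra.
Qed.

(** Factoring the polynomial over the complex numbers replaces a compactness argument. A root other
    than [z] lies outside the box, so one coordinate separates it from the whole box by a fixed
    amount; the factors at [z] are at least [t]. *)
Lemma int_eval_away (e : entry_code) (z : C) (t : R) : entry_denotes e z -> 0 < t ->
  exists2 eta, 0 < eta & forall w, in_box e w -> t <= normc (w - z) -> eta <= normc (int_eval e.1 w).
Proof.
move=> [p0 [_ [_ uz]]] t0.
have [r er] := closed_field_poly_normal (entry_poly R e).
have far (x : C) : root (entry_poly R e) x -> exists2 h, 0 < h &
    forall w, in_box e w -> t <= normc (w - z) -> h <= normc (w - x).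
  move=> rx; have [bx|] := boolP (in_box e x); first by exists t => // w _; rewrite (uz x rx bx).
  have hRe (w : C) : `|complex.Re w - complex.Re x| <= normc (w - x).
    by have := normc_ReB (w - x); rewrite raddfB.
  have hIm (w : C) : `|complex.Im w - complex.Im x| <= normc (w - x).
    by have := normc_ImB (w - x); rewrite raddfB.
  move: {uz p0 er rx} e => [cs [[[a b] c] d]]; rewrite /in_box /= !negb_and -!ltNge.
  by move=> /orP[/orP[h|h]|/orP[h|h]];
    [exists (ratr a - complex.Re x)|exists (complex.Re x - ratr b)
    |exists (ratr c - complex.Im x)|exists (complex.Im x - ratr d)]; rewrite ?subr_gt0 //;
    move=> w /andP[/andP[h1 h2] /andP[h3 h4]] _;
    [apply: le_trans (hRe w)|apply: le_trans (hRe w)|apply: le_trans (hIm w)|apply: le_trans (hIm w)];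
    rewrite ler_normr; lra.
have hr : forall x, x \in r -> root (entry_poly R e) x.
  by move=> x xr; rewrite er rootZ ?lead_coef_eq0 // root_prod_XsubC.
have [eta eta0 heta] : exists2 eta, 0 < eta & forall w, in_box e w -> t <= normc (w - z) ->
    eta <= normc (\prod_(x <- r) (w - x)).
  elim: r hr {er} => [|x r IH] hr.
    by exists 1 => // w _ _; rewrite big_nil ComplexField.Normc.normc1.
  have [h1 h10 H1] := IH (fun y yr => hr y (mem_behead (s := x :: r) yr)).
  have [h2 h20 H2] := far x (hr x (mem_head _ _)).
  exists (h2 * h1); first exact: mulr_gt0.
  move=> w bw tw; rewrite big_cons ComplexField.Normc.normcM.
  by apply: ler_pM; rewrite ?(ltW h10) ?(ltW h20) ?H1 ?H2.
exists (normc (lead_coef (entry_poly R e)) * eta).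
  by rewrite mulr_gt0 // lt_neqAle normc_ge0 eq_sym normc_eq0 lead_coef_eq0 p0.
move=> w bw tw; rewrite -entry_polyE er hornerZ ComplexField.Normc.normcM lead_coefZ.
rewrite (monicP (monic_prod_XsubC _ _ _)) mulr1 horner_prod.
under eq_bigr do rewrite hornerXsubC.
by apply: ler_wpM2l; [exact: normc_ge0|exact: heta].
Qed.

Lemma entry_test_complete (e : entry_code) (z : C) (P : int * int * int) T :
  entry_denotes e z -> (0 < T)%N -> 0 < P.2 ->
  normc (z - gval R P.1 / P.2%:~R) < (4 * T)%:R^-1 ->
  exists N0, forall N, (N0 <= N)%N -> entry_test e P T N.
Proof.
move=> de T0 P0 hz; have T0' : 0 < T%:R :> R by rewrite ltr0n.
have t0 : 0 < (4 * T)%:R^-1 :> R by rewrite invr_gt0 ltr0n muln_gt0.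
have [eta eta0 heta] := int_eval_away de t0.
have [_ [_ [bz _]]] := de.
(* The first bound is required by the test itself; the second ensures [entry_lip e < eta * N]. *)
exists (maxn (4 * box_bound e * T).+1 (Num.truncn ((entry_lip e)%:R / eta)).+1) => N.
rewrite geq_max => /andP[h1 h2]; rewrite /entry_test h1 andTb.
have N0 : (0 < N)%N by lia.
apply/allP => i; rewrite mem_iota add0n ltnS => /andP[_ iN].
apply/allP => j; rewrite mem_iota add0n ltnS => /andP[_ jN].
rewrite grid_farE // grid_nearE // orbC; set w := grid_point _ _ _ _.
case: (leP _ 1) => [_|far]; first by rewrite orTb.
rewrite orFb.
have bw : in_box e w by apply: grid_point_in_box bz _ _ _.
(* A point that is not near [P] is more than [1 / (2 T)] from it, while [z] is closer than
   [1 / (4 T)] to [P]. *)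
have hw : (4 * T)%:R^-1 <= normc (w - z).
  have := normc_dist w z (gval R P.1 / P.2%:~R); move: far.
  rewrite -ltr_pdivrMr ?ltr0n ?muln_gt0 // mul1r; move: hz.
  rewrite !natrM !invfM; have : 0 < (T%:R : R)^-1 by rewrite invr_gt0.
  by move: (T%:R^-1) (normc _) (normc _) (normc _) => u x y v; lra.
apply: lt_le_trans (_ : eta * N%:R <= _); last by rewrite ler_wpM2r // heta.
rewrite -ltr_pdivrMl // mulrC; apply: lt_le_trans (Num.Theory.truncnS_gt _) _.
by rewrite ler_nat.
Qed.

End EntryTest.

(** * Density of Gaussian rational orthogonal families *)

Section Density.
Variable R : realType.
Local Notation C := R[i].

Definition cvC (x : nat -> C) (l : C) :=
  forall e : R, 0 < e -> exists N, forall n, (N <= n)%N -> normc (x n - l) < e.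

Lemma cvCD x y l m : cvC x l -> cvC y m -> cvC (fun n => x n + y n) (l + m).
Proof.
move=> hx hy e e0; have e2 : 0 < e / 2 by rewrite divr_gt0.
have [N hN] := hx _ e2; have [N' hN'] := hy _ e2.
exists (maxn N N') => n; rewrite geq_max => /andP[/hN h1 /hN' h2].
rewrite opprD addrACA; apply: le_lt_trans (normc_triangle _ _) _.
by rewrite [e]splitr ltrD.
Qed.

Lemma cvCM x y l m : cvC x l -> cvC y m -> cvC (fun n => x n * y n) (l * m).
Proof.
move=> hx hy e e0.
have m0 : 0 < normc m + 1 by rewrite ltr_wpDl ?normc_ge0.
have l0 : 0 < normc l + 1 by rewrite ltr_wpDl ?normc_ge0.
have [N1 h1] := hx (e / 2 / (normc m + 1)) ltac:(by rewrite !divr_gt0).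
have [N2 h2] := hy (e / 2 / (normc l + 1)) ltac:(by rewrite !divr_gt0).
have [N3 h3] := hy 1 ltr01.
exists (maxn N1 (maxn N2 N3)) => n; rewrite !geq_max => /and3P[/h1 {}h1 /h2 {}h2 /h3 {}h3].
have -> : x n * y n - l * m = (x n - l) * y n + l * (y n - m) by ring.
apply: le_lt_trans (normc_triangle _ _) _; rewrite !ComplexField.Normc.normcM.
have hy' : normc (y n) <= normc m + 1.
  by have := normc_dist (y n) m 0; rewrite !subr0; move/ltW: h3; lra.
move: h1 h2; rewrite !ltr_pdivlMr // => h1 h2.
have g1 : normc (x n - l) * normc (y n) <= normc (x n - l) * (normc m + 1).
  by rewrite ler_wpM2l ?normc_ge0.
have g2 : normc l * normc (y n - m) <= normc (y n - m) * (normc l + 1).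
  by rewrite mulrC ler_wpM2l ?normc_ge0 // lerDl.
by lra.
Qed.

Lemma cvCJ x l : cvC x l -> cvC (fun n => conjc (x n)) (conjc l).
Proof. by move=> hx e /hx[N hN]; exists N => n /hN; rewrite -rmorphB normc_conj. Qed.

Lemma cvCB x y l m : cvC x l -> cvC y m -> cvC (fun n => x n - y n) (l - m).
Proof.
move=> hx hy; apply: cvCD => // e /hy[N hN]; exists N => n /hN.
by rewrite -opprD normcN.
Qed.

Lemma cvCV x l : l != 0 -> cvC x l -> cvC (fun n => (x n)^-1) l^-1.
Proof.
move=> l0 hx e e0; have nl : 0 < normc l by rewrite lt_neqAle normc_ge0 eq_sym normc_eq0 l0.
have [N1 h1] := hx (normc l / 2) ltac:(by rewrite divr_gt0).
have [N2 h2] := hx (e * (normc l / 2 * normc l)) ltac:(by rewrite !mulr_gt0 // divr_gt0).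
exists (maxn N1 N2) => n; rewrite geq_max => /andP[/h1 {}h1 /h2 {}h2].
have nx : normc l / 2 <= normc (x n).
  by have := normc_dist l (x n) 0; rewrite !subr0 normcB; move/ltW: h1; lra.
have x0 : x n != 0 by rewrite -normc_eq0 gt_eqF // (lt_le_trans _ nx) // divr_gt0.
have -> : (x n)^-1 - l^-1 = (l - x n) / (x n * l) by field; rewrite x0 l0.
rewrite ComplexField.Normc.normcM ComplexField.Normc.normcV ComplexField.Normc.normcM normcB.
rewrite ltr_pdivrMr; last by rewrite mulr_gt0 // (lt_le_trans _ nx) // divr_gt0.
by apply: lt_le_trans h2 _; rewrite ler_pM2l // ler_wpM2r // ltW.
Qed.

Lemma cvC_sum (I : Type) (r : seq I) (P : pred I) (x : I -> nat -> C) (l : I -> C) :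
  (forall i, P i -> cvC (x i) (l i)) ->
  cvC (fun n => \sum_(i <- r | P i) x i n) (\sum_(i <- r | P i) l i).
Proof.
move=> h; elim: r => [|i r IH].
  by move=> e e0; exists 0%N => n _; rewrite !big_nil subrr ComplexField.Normc.normc0.
have [Pi|nPi] := boolP (P i).
  move=> e e0; have [N hN] := cvCD (h i Pi) IH e0.
  by exists N => n /hN; rewrite !big_cons Pi.
by move=> e /IH[N hN]; exists N => n /hN; rewrite !big_cons (negbTE nPi).
Qed.

Definition gauss_rat (z : C) := exists a b : rat, z = Complex (ratr a) (ratr b).

Lemma gauss_rat0 : gauss_rat 0.
Proof. by exists 0, 0; rewrite rmorph0. Qed.
Lemma gauss_ratD z w : gauss_rat z -> gauss_rat w -> gauss_rat (z + w).
Proof. by move=> [a [b ->]] [c [d ->]]; exists (a + c), (b + d); rewrite !rmorphD. Qed.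
Lemma gauss_ratM z w : gauss_rat z -> gauss_rat w -> gauss_rat (z * w).
Proof.
move=> [a [b ->]] [c [d ->]]; exists (a * c - b * d), (a * d + b * c).
by rewrite rmorphB rmorphD !rmorphM.
Qed.
Lemma gauss_ratJ z : gauss_rat z -> gauss_rat (conjc z).
Proof. by move=> [a [b ->]]; exists a, (- b); rewrite rmorphN. Qed.
Lemma gauss_ratN z : gauss_rat z -> gauss_rat (- z).
Proof. by move=> [a [b ->]]; exists (- a), (- b); rewrite !rmorphN. Qed.
Lemma gauss_ratV z : gauss_rat z -> gauss_rat z^-1.
Proof.
move=> [a [b ->]]; exists (a / (a ^+ 2 + b ^+ 2)), (- (b / (a ^+ 2 + b ^+ 2))).
by rewrite rmorphN !fmorph_div rmorphD !rmorphXn.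
Qed.
Lemma gauss_rat_sum (I : Type) (r : seq I) (P : pred I) (F : I -> C) :
  (forall i, gauss_rat (F i)) -> gauss_rat (\sum_(i <- r | P i) F i).
Proof. by move=> h; elim/big_ind: _ => // [|x y]; [exact: gauss_rat0|exact: gauss_ratD]. Qed.

Lemma gauss_rat_dense z : exists2 x, forall n, gauss_rat (x n) & cvC x z.
Proof.
case: z => a b.
pose q (u : R) n : rat := (Num.floor (u * n.+1%:R))%:~R / n.+1%:R.
have hq u n : `|ratr (q u n) - u| <= n.+1%:R^-1.
  have n0 : 0 < n.+1%:R :> R by rewrite ltr0n.
  rewrite /q fmorph_div /= rmorph_int rmorph_nat.
  have /andP[h1 h2] := floor_itv (u * n.+1%:R).
  rewrite -[X in _ - X](mulfK (lt0r_neq0 n0)) -mulrBl normrM normfV (gtr0_norm n0).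
  rewrite ler_piMl ?invr_ge0 ?(ltW n0) // ler_norml; move: h2; rewrite intrD /=.
  by move: h1; lra.
exists (fun n => Complex (ratr (q a n)) (ratr (q b n))); first by move=> n; exists (q a n), (q b n).
move=> e e0; exists (Num.truncn (2 / e)) => n hn.
apply: le_lt_trans (normc_le_add _) _ => /=.
apply: le_lt_trans (lerD (hq a n) (hq b n)) _.
have n0 : 0 < n.+1%:R :> R by rewrite ltr0n.
have -> : n.+1%:R^-1 + n.+1%:R^-1 = 2 / n.+1%:R :> R by field; rewrite lt0r_neq0.
rewrite ltr_pdivrMr // mulrC -ltr_pdivrMr //.
by apply: lt_le_trans (Num.Theory.truncnS_gt _) _; rewrite ler_nat ltnS.
Qed.

Section GramSchmidt.
Variable I : finType.
Definition inn (u v : I -> C) : C := \sum_i conjc (u i) * v i.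

Lemma innJ u v : conjc (inn u v) = inn v u.
Proof.
by rewrite /inn rmorph_sum; apply: eq_bigr => i _; rewrite rmorphM /= conjcK mulrC.
Qed.

Lemma inn_eq0 u : inn u u = 0 -> forall i, u i = 0.
Proof.
rewrite /inn; under eq_bigr do rewrite mulrC mul_conjc.
rewrite -rmorph_sum => /complexI /eqP; rewrite psumr_eq0 => [/allP h i|i _]; last exact: sqr_ge0.
by apply/eqP; have := h i (mem_index_enum _); rewrite sqrf_eq0 normc_eq0.
Qed.

Lemma inn_subsum r v x (c : 'I_r -> C) (w : 'I_r -> I -> C) :
  inn v (fun i => x i - \sum_k c k * w k i) = inn v x - \sum_k c k * inn v (w k).
Proof.
rewrite /inn; under eq_bigr do rewrite mulrBr mulr_sumr.
rewrite sumrB exchange_big /=; congr (_ - _); apply: eq_bigr => k _.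
by rewrite mulr_sumr; apply: eq_bigr => i _; ring.
Qed.

(* Gram-Schmidt without normalization keeps the coordinates rational; where
   [U j n] vanishes, the junk value [0^-1 = 0] still gives orthogonality. *)
Lemma gauss_rat_orthogonal (r : nat) (y : nat -> I -> C) :
  (forall k l, (k < r)%N -> (l < r)%N -> inn (y k) (y l) = (k == l)%:R) ->
  exists U : nat -> nat -> I -> C, [/\ forall k n i, (k < r)%N -> gauss_rat (U k n i),
    forall k i, (k < r)%N -> cvC (fun n => U k n i) (y k i) &
    forall k l n, (k < r)%N -> (l < r)%N -> k != l -> inn (U k n) (U l n) = 0].
Proof.
elim: r => [|r IH] hy; first by exists (fun _ _ _ => 0); split.
have [U [hU cU oU]] := IH (fun k l hk hl => hy k l (leqW hk) (leqW hl)).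
have /choice[x hx] : forall i, exists x, (forall n, gauss_rat (x n)) /\ cvC x (y r i).
  by move=> i; have [x] := gauss_rat_dense (y r i); exists x.
pose X n i := x i n.
pose u n i := X n i - \sum_(k < r) inn (U k n) (X n) / inn (U k n) (U k n) * U k n i.
have inn_rat v w : (forall i, gauss_rat (v i)) -> (forall i, gauss_rat (w i)) -> gauss_rat (inn v w).
  by move=> hv hw; apply: gauss_rat_sum => i; apply: gauss_ratM => //; apply: gauss_ratJ.
have inn_cv (v w : nat -> I -> C) a b : (forall i, cvC (v^~ i) (a i)) -> (forall i, cvC (w^~ i) (b i)) ->
    cvC (fun n => inn (v n) (w n)) (inn a b).
  by move=> hv hw; apply: cvC_sum => i _; apply: cvCM => //; apply: cvCJ.
have hX n i : gauss_rat (X n i) by have [h _] := hx i; apply: h.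
have cX i : cvC (X^~ i) (y r i) by have [_] := hx i.
have ou l n : (l < r)%N -> inn (U l n) (u n) = 0.
  move=> lr.
  rewrite /u inn_subsum.
  rewrite (bigD1 (Ordinal lr)) //= big1 ?addr0 => [|k kl]; last first.
    rewrite (oU l k) ?mulr0 ?ltn_ord //; apply: contra kl => /eqP e.
    by apply/eqP/val_inj; rewrite /= e.
  have [z|nz] := eqVneq (inn (U l n) (U l n)) 0; last by rewrite mulfVK ?subrr.
  rewrite z mulr0 subr0 /inn big1 // => i _; by rewrite (inn_eq0 z) conjc0 mul0r.
exists (fun k => if (k < r)%N then U k else u); split.
- move=> k n i; rewrite ltnS leq_eqVlt => /orP[/eqP->|kr]; last by rewrite kr; apply: hU.
  rewrite ltnn; apply: gauss_ratD => //; apply: gauss_ratN; apply: gauss_rat_sum => k'.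
  apply: gauss_ratM; last exact: hU.
  by apply: gauss_ratM; [|apply: gauss_ratV]; apply: inn_rat => // j; apply: hU.
- move=> k i; rewrite ltnS leq_eqVlt => /orP[/eqP->|kr]; last by rewrite kr; apply: cU.
  rewrite ltnn.
  (* The Gram-Schmidt corrections tend to this sum, which vanishes because the limits are already
     orthonormal; so the corrected vectors still tend to [y r]. *)
  have e0 : \sum_(k < r) inn (y k) (y r) / inn (y k) (y k) * y k i = 0.
    rewrite big1 // => k' _; rewrite hy ?ltnS ?(ltnW (ltn_ord k')) //.
    by rewrite ltn_eqF ?mul0r.
  rewrite -[y r i]subr0 -e0; apply: cvCB => //.
  apply: cvC_sum => k' _.
  apply: cvCM; last exact: cU.
  apply: cvCM; first by apply: inn_cv => // j; apply: cU.
  apply: cvCV; first by rewrite hy ?eqxx ?oner_neq0 ?ltnS ?(ltnW (ltn_ord k')).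
  by apply: inn_cv => j; apply: cU.
- move=> k l n; rewrite !ltnS leq_eqVlt => /orP[/eqP->|kr]; rewrite leq_eqVlt => /orP[/eqP->|lr] //.
  + by rewrite eqxx.
  + by move=> _; rewrite ltnn lr -innJ ou // conjc0.
  + by move=> _; rewrite kr ltnn ou.
  + by move=> kl; rewrite kr lr oU.
Qed.

End GramSchmidt.
End Density.

Section ProjectionDense.
Variable R : realType.
Local Notation C := R[i].

Lemma gauss_rat_scale (I : finType) (u : I -> C) : (forall i, gauss_rat (u i)) ->
  exists D : int, 0 < D /\ exists w : I -> int * int, forall i, gval R (w i) = D%:~R * u i.
Proof.
move=> hu; suff [D [D0 h]] : exists D : int, 0 < D /\
    forall i, i \in enum I -> exists w, gval R w = D%:~R * u i.
  exists D; split=> //; have /choice[w hw] : forall i, exists w, gval R w = D%:~R * u i.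
    by move=> i; apply: h; rewrite mem_enum.
  by exists w.
elim: (enum I) => [|i s [D [D0 h]]]; first by exists 1.
have [a [b eu]] := hu i.
exists (D * (denq a * denq b)); split; first by rewrite !mulr_gt0 ?denq_gt0.
move=> j; rewrite inE => /orP[/eqP->|/h[w hw]]; last first.
  by exists (gscale (denq a * denq b) w); rewrite gvalZ hw [(D * _)%:~R]rmorphM /=; ring.
exists (D * (numq a * denq b), D * (denq a * numq b)); rewrite eu !ratrE.
have := denq_neq0 a; have := denq_neq0 b; rewrite -!(intr_eq0 R) => hb ha.
rewrite -(rmorph_int (real_complex R)) /gval /= !rmorphM /=; simpc.
by congr Complex; field.
Qed.

(** Spectral theorem for normal matrices: the vectors [y k] are the conjugated rows of the
    diagonalizing unitary, and [lam] marks the eigenvalue 1. *)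
Lemma projection_basis d (S : 'M[C]_d) : Defs.hermitian S -> S *m S = S ->
  exists (y : nat -> 'I_d -> C) (lam : nat -> bool),
  (forall k l, (k < d)%N -> (l < d)%N -> inn (y k) (y l) = (k == l)%:R) /\
  (forall i j, S i j = \sum_(k < d | lam k) y k i * conjc (y k j)).
Proof.
move=> hS S2.
have Sn : S \is normalmx.
  apply/normalmxP; suff -> : map_mx Num.conj S^T = S by [].
  by apply/matrixP => i j; rewrite !mxE -[Num.conj _]/(conjc _) hS conjcK.
have := orthomx_spectralP Sn; set P := spectralmx S; set sp := spectral_diag S => eS.
have uP : P \is unitarymx by apply: spectral_unitarymx.
have Pu : P \in unitmx by apply: unitarymx_unit.
(* Idempotence of [S] passes to the diagonal, so every eigenvalue is 0 or 1. *)
have sp2 k : sp 0 k * sp 0 k = sp 0 k.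
  have : diag_mx sp *m diag_mx sp = diag_mx sp.
    have eD : diag_mx sp = P *m S *m invmx P by rewrite eS !mulmxA mulmxV // mul1mx mulmxK.
    by rewrite {1 2}eD !mulmxA mulmxKV // -(mulmxA P) S2 -eD.
  by move=> /matrixP/(_ k k); rewrite mulmx_diag !mxE eqxx !mulr1n.
(* Indices are extended from ['I_d] to all natural numbers, as required by the induction on the
   number of vectors in [gauss_rat_orthogonal]; the value beyond [d] is a dummy. *)
pose y k i : C := oapp (fun k' : 'I_d => conjc (P k' i)) 0 (insub k).
pose lam k := oapp (fun k' : 'I_d => sp 0 k' != 0) false (insub k).
exists y, lam; split.
  move=> k l kd ld; rewrite /inn /y !insubT /=.
  have /unitarymxP/matrixP/(_ (Ordinal kd) (Ordinal ld)) := uP.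
  rewrite !mxE -[Sub _ _]/(Ordinal kd) -[Sub _ _]/(Ordinal ld) => e; rewrite -[RHS]e.
  by apply: eq_bigr => i _; rewrite conjcK !mxE.
move=> i j; rewrite [in LHS]eS invmx_unitary // mxE.
rewrite [RHS]big_mkcond /=; apply: eq_bigr => k _.
rewrite /y /lam valK /= conjcK mul_mx_diag !mxE -[Num.conj _]/(conjc _).
have [->|nz] := eqVneq (sp 0 k) 0; first by rewrite mulr0 mul0r.
suff -> : sp 0 k = 1 by rewrite mulr1.
by apply: (mulfI nz); rewrite sp2 mulr1.
Qed.

(** The whole eigenbasis is approximated by orthogonal Gaussian rational vectors. The projections
    onto the span of those marked by [lam] converge to [S]; a late one is kept, with denominators
    cleared. *)
Lemma projection_dense d (S : 'M[C]_d) (e : R) : Defs.hermitian S -> S *m S = S -> 0 < e ->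
  exists us, orthogonal_family d us /\
    forall i j : 'I_d, normc (S i j - proj_entry R us i j) < e.
Proof.
move=> hS S2 e0; have [y [lam [oy eS]]] := projection_basis hS S2.
have [U [hU cU oU]] := gauss_rat_orthogonal oy.
have cN k : (k < d)%N -> cvC (fun n => inn (U k n) (U k n)) 1.
  move=> kd; rewrite -[1]/(true%:R) -(eqxx k) -oy //.
  by apply: cvC_sum => i _; apply: cvCM; [apply: cvCJ|]; apply: cU.
pose Q n i j : C := \sum_(k < d | lam k) U k n i * conjc (U k n j) / inn (U k n) (U k n).
have cQ i j : cvC (fun n => Q n i j) (S i j).
  rewrite eS; apply: cvC_sum => k _; rewrite -[X in cvC _ X]mulr1 -[X in _ * X]invr1.
  apply: cvCM; first by apply: cvCM; [|apply: cvCJ]; apply: cU.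
  by apply: cvCV; [exact: oner_neq0|apply: cN].
have ev (J : finType) (B : J -> nat -> Prop) : (forall i, exists N, forall n, (N <= n)%N -> B i n) ->
    exists N, forall n i, (N <= n)%N -> B i n.
  move=> /choice[N hN]; exists (\max_i N i) => n i hn; apply: hN.
  exact: leq_trans (leq_bigmax i) hn.
have [N1 h1] := ev _ (fun (p : 'I_d * 'I_d) n => normc (Q n p.1 p.2 - S p.1 p.2) < e)
  (fun p => cQ p.1 p.2 e e0).
(* Squared norms within 1 of 1 are nonzero, as the positivity in [orthogonal_family] demands. *)
have [N2 h2] := ev _ (fun (k : 'I_d) n => normc (inn (U k n) (U k n) - 1) < 1)
  (fun k => cN k (ltn_ord k) 1 ltr01).
pose n := maxn N1 N2.
have {}h1 i j : normc (Q n i j - S i j) < e by apply: (h1 n (i, j)); rewrite leq_maxl.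
have {}h2 k : (k < d)%N -> inn (U k n) (U k n) != 0.
  move=> kd; have := h2 n (Ordinal kd) (leq_maxr _ _); apply: contraTneq => /= ->.
  by rewrite sub0r normcN ComplexField.Normc.normc1 ltxx.
have /choice[D /choice[w hw]] : forall k, exists D : int, exists w : 'I_d -> int * int,
    (k < d)%N -> 0 < D /\ forall i, gval R (w i) = D%:~R * U k n i.
  move=> k; case: (ltnP k d) => kd; last by exists 0, (fun=> (0, 0)).
  have [D [D0 [w hw]]] := gauss_rat_scale (fun i => hU k n i kd).
  by exists D, w.
pose F k := [seq w k i | i <- enum 'I_d].
have sF k : size (F k) = d by rewrite size_map size_enum_ord.
have nF k (i : 'I_d) : gnth (F k) i = w k i.
  by rewrite /gnth (nth_map i) ?size_enum_ord // nth_ord_enum.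
have iF k l : (k < d)%N -> (l < d)%N ->
    gval R (ginner (F k) (F l)) = (D k)%:~R * (D l)%:~R * inn (U k n) (U l n).
  move=> kd ld; rewrite gval_inner sF /inn mulr_sumr; apply: eq_bigr => i _.
  rewrite !nF; have [_ ->] := hw k kd; have [_ ->] := hw l ld.
  by rewrite rmorphM /= rmorph_int; ring.
have D0 k : (k < d)%N -> (D k)%:~R != 0 :> C by move=> /hw[h _]; rewrite intr_eq0 gt_eqF.
have nFk k : (k < d)%N -> (gsqnorm (F k))%:~R = (D k)%:~R * (D k)%:~R * inn (U k n) (U k n) :> C.
  by move=> kd; rewrite gsqnorm_inner iF.
have pF k : (k < d)%N -> 0 < gsqnorm (F k).
  move=> kd; rewrite lt_neqAle -(ler_int R) gsqnormE; apply/andP; split; last first.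
    by apply: sumr_ge0 => i _; apply: sqr_ge0.
  rewrite eq_sym -(intr_eq0 C) nFk // !mulf_neq0 ?D0 ?h2 //.
pose s := [seq k <- iota 0 d | lam k].
have sd k : k \in s -> (k < d)%N by rewrite mem_filter mem_iota => /and3P[].
exists [seq F k | k <- s]; split.
  apply/andP; split.
    apply/allP => _ /mapP[k /sd kd ->]; by rewrite sF eqxx pF.
  apply/allP => i; rewrite size_map mem_iota => /andP[_ hi].
  apply/allP => j; rewrite mem_iota => /andP[_ hj]; rewrite add0n in hi hj.
  case: leqP => //= ij; rewrite !(nth_map 0%N) // (gval_eq0 R) iF ?sd ?mem_nth // oU ?mulr0 ?sd ?mem_nth //.
  by rewrite nth_uniq ?filter_uniq ?iota_uniq // ltn_eqF.
(* Scaling a vector by the integer [D k] does not change the projection onto its line. *)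
move=> i j; rewrite normcB; suff -> : proj_entry R [seq F k | k <- s] i j = Q n i j by [].
rewrite /proj_entry big_map big_filter /Q -(big_mkord lam (fun k => U k n i * conjc (U k n j) / inn (U k n) (U k n))).
rewrite /index_iota subn0 big_seq_cond [RHS]big_seq_cond; apply: eq_bigr => k /andP[]; rewrite mem_iota add0n => /andP[_ kd] _.
rewrite !nF nFk //; have [_ hwk] := hw k kd; rewrite !hwk rmorphM /= rmorph_int.
by field; rewrite D0 ?h2.
Qed.

End ProjectionDense.

(** * Normalized families and density matrices *)

Section UnitFamily.
Variable R : realType.
Local Notation C := R[i].
Implicit Types (x : int * int) (us : seq (seq (int * int))).

Definition unit_scale (s : int) : R := Num.sqrt s%:~R.
Definition unit_val (s : int) x : C := gval R x / (unit_scale s)%:C%C.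

Lemma conjcM (z w : C) : conjc (z * w) = conjc z * conjc w.
Proof. exact: rmorphM. Qed.

Lemma conjc_div_real (z : C) (r : R) : conjc (z / r%:C%C) = conjc z / r%:C%C.
Proof. by case: z => a b; rewrite divc_real /= divc_real mulNr. Qed.

Lemma unit_scale_ge1 s : 0 < s -> 1 <= unit_scale s.
Proof.
move=> s0; rewrite /unit_scale -[X in X <= _]sqrtr1; apply: ler_wsqrtr.
by rewrite ler1z; lia.
Qed.

Lemma sqr_unit_scale s : 0 < s -> (unit_scale s)%:C%C ^+ 2 = s%:~R :> C.
Proof.
by move=> s0; rewrite -rmorphXn /= /unit_scale sqr_sqrtr ?ler0z ?ltW // rmorph_int.
Qed.

Lemma unit_scale_neq0 s : 0 < s -> (unit_scale s)%:C%C != 0 :> C.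
Proof.
move=> /unit_scale_ge1 h; rewrite eq_complex /= eqxx andbT gt_eqF //.
exact: lt_le_trans ltr01 h.
Qed.

Lemma unit_entry_evalE s x (z : C) : int_eval (unit_entry s x).1 z =
  (s%:~R * z ^+ 2 - gval R x ^+ 2) * (s%:~R * z ^+ 2 - conjc (gval R x) ^+ 2).
Proof.
rewrite /int_eval; set g := conjc _; rewrite /= rmorphN !rmorphM /=.
have -> : (gnorm2 x)%:~R = gval R x * g :> C.
  by rewrite mul_conjc gval_norm rmorph_int.
have e : 2%:~R * (x.1 * x.1 - x.2 * x.2)%:~R = gval R x ^+ 2 + g ^+ 2 :> C.
  rewrite /g -!(rmorph_int (real_complex R)) /gval /= !expr2 rmorphB !rmorphM /=; simpc.
  by congr Complex; ring.
by rewrite e; ring.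
Qed.

(** The interval reaches from 0 to [a] and so contains only numbers of the sign of [a]; when [a = 0]
    the two candidates coincide. *)
Lemma quadrant_unique (a : int) (r u : R) : 1 <= r -> u = a%:~R / r \/ u = - (a%:~R / r) ->
  ratr (if a < 0 then a else 0)%:~R <= u <= ratr (if 0 < a then a else 0)%:~R ->
  u = a%:~R / r.
Proof.
rewrite !ratr_int => r1 [//|->]; have r0 : 0 < r^-1 by rewrite invr_gt0 (lt_le_trans ltr01).
case: (ltrgtP a 0) => [a0|a0|->]; last by rewrite mul0r oppr0.
- by move=> /andP[_]; rewrite mulr0z oppr_le0 pmulr_lge0 // ler0z leNgt a0.
- by move=> /andP[]; rewrite mulr0z oppr_ge0 pmulr_lle0 // lerz0 leNgt a0.
Qed.

Lemma quadrant_mem (a : int) (r : R) : 1 <= r ->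
  ratr (if a < 0 then a else 0)%:~R <= a%:~R / r <= ratr (if 0 < a then a else 0)%:~R.
Proof.
rewrite !ratr_int => r1; have r0 : 0 < r by rewrite (lt_le_trans ltr01).
case: (ltrgtP a 0) => [a0|a0|->]; last by rewrite mul0r lexx.
- have a0' : a%:~R < 0 :> R by rewrite ltrz0.
  rewrite mulr0z; apply/andP; split; last by rewrite ltW // pmulr_llt0 ?invr_gt0.
  by rewrite ler_pdivlMr //; nra.
- have a0' : 0 < a%:~R :> R by rewrite ltr0z.
  rewrite mulr0z; apply/andP; split; first by rewrite ltW // divr_gt0.
  by rewrite ler_pdivrMr //; nra.
Qed.

(** The roots are [g / sqrt s], its conjugate and their opposites, where [g] is the value of [x].
    Each coordinate is thus known up to sign, and the box selects the sign; [1 <= sqrt s] keeps the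
    intended root inside the box. *)
Lemma unit_entry_denotes s x : 0 < s -> entry_denotes (unit_entry s x) (unit_val s x).
Proof.
move=> s0; have r1 := unit_scale_ge1 s0; have r0 := unit_scale_neq0 s0.
have r2 := sqr_unit_scale s0.
have eval : forall z : C, root (entry_poly R (unit_entry s x)) z =
    ((s%:~R * z ^+ 2 - gval R x ^+ 2) * (s%:~R * z ^+ 2 - conjc (gval R x) ^+ 2) == 0).
  by move=> z; rewrite rootE entry_polyE unit_entry_evalE.
have zE : unit_val s x = Complex (x.1%:~R / unit_scale s) (x.2%:~R / unit_scale s).
  by rewrite /unit_val divc_real.
split; [|split; [|split]].
- apply/eqP => /polyP/(_ 4%N); rewrite /entry_poly coef_map_id0 // coef_Poly coef0 /= => /eqP.
  by rewrite intr_eq0 mulf_eq0 gt_eqF.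
- rewrite eval /unit_val -r2 mulf_eq0; apply/orP; left.
  by apply/eqP; field.
- by rewrite zE /in_box /= !quadrant_mem.
- move=> w; rewrite eval -r2 => hw.
  have [hR hI] : (complex.Re w = x.1%:~R / unit_scale s \/ complex.Re w = - (x.1%:~R / unit_scale s)) /\
      (complex.Im w = x.2%:~R / unit_scale s \/ complex.Im w = - (x.2%:~R / unit_scale s)).
    have key (z v : C) : (unit_scale s)%:C%C ^+ 2 * z ^+ 2 - v ^+ 2 = 0 ->
        z = v / (unit_scale s)%:C%C \/ z = - (v / (unit_scale s)%:C%C).
      move=> /eqP; rewrite -exprMn subr_eq0 eqf_sqr => /orP[/eqP e|/eqP e]; [left|right].
        by rewrite -e mulrC mulKf.
      by rewrite -mulNr -e mulrC mulKf.
    move: hw; rewrite mulf_eq0 => /orP[/eqP/key|/eqP/key]; rewrite /gval /= divc_real.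
      by move=> [->|->] /=; split; by [left|right].
    by rewrite mulNr => -[->|->] /=; rewrite ?opprK; split; by [left|right].
  rewrite /in_box /= => /andP[/(quadrant_unique r1 hR) eR /(quadrant_unique r1 hI) eI].
  by rewrite zE -eR -eI; case: (w).
Qed.

Definition unit_vectors us : seq (seq C) :=
  [seq [seq unit_val (gsqnorm u) x | x <- u] | u <- us].

Lemma unit_family_codes d us : orthogonal_family d us ->
  codes_set (pickle (unit_family us)) (unit_vectors us).
Proof.
move=> /andP[/allP hus _]; exists (unit_family us); split; first exact: pickleK.
rewrite !size_map; split=> // i hi; rewrite !(nth_map [::]) //.
have /andP[_ s0] := hus _ (mem_nth [::] hi).
split=> [|j]; rewrite !size_map // => hj; rewrite !(nth_map (0, 0)) //.
exact: unit_entry_denotes.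
Qed.

Lemma gnth_unit u s i : nth 0 [seq unit_val s x | x <- u] i = unit_val s (gnth u i).
Proof.
have [hi|hi] := ltnP i (size u); first by rewrite (nth_map (0, 0)).
by rewrite nth_default ?size_map // /gnth nth_default // /unit_val mul0r.
Qed.

Lemma unit_vectors_orthonormal d us : orthogonal_family d us -> Defs.orthonormal (unit_vectors us).
Proof.
move=> /andP[/allP hus /allP ous] i j; rewrite size_map => hi hj.
have /andP[/eqP si pi] := hus _ (mem_nth [::] hi); have /andP[/eqP sj pj] := hus _ (mem_nth [::] hj).
rewrite /unit_vectors !(nth_map [::]) //.
have -> u v : inner [seq unit_val (gsqnorm u) x | x <- u] [seq unit_val (gsqnorm v) x | x <- v] =
    gval R (ginner u v) / ((unit_scale (gsqnorm u))%:C%C * (unit_scale (gsqnorm v))%:C%C).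
  rewrite /inner size_map gval_inner mulr_suml; apply: eq_bigr => k _.
  by rewrite !gnth_unit /unit_val conjc_div_real invfM; ring.
have orth (a b : nat) : (a < b)%N -> (b < size us)%N ->
    gval R (ginner (nth [::] us a) (nth [::] us b)) = 0.
  move=> ab hb; have ha := ltn_trans ab hb.
  have inI c : (c < size us)%N -> c \in iota 0 (size us) by rewrite mem_iota.
  have /allP/(_ b (inI b hb)) := ous a (inI a ha).
  by rewrite leqNgt ab /= (gval_eq0 R) => /eqP.
case: (ltngtP i j) => [ij|ji|<-].
- by rewrite orth ?mul0r.
(* Only pairs with [i < j] are tested in [orthogonal_family]; the others follow by conjugation. *)
- rewrite -[gval R _]conjcK gval_inner rmorph_sum /=.
  have -> : \sum_(k < size (nth [::] us i)) conjc (conjc (gval R (gnth (nth [::] us i) k)) * gval R (gnth (nth [::] us j) k))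
     = gval R (ginner (nth [::] us j) (nth [::] us i)).
    by rewrite gval_inner si sj; apply: eq_bigr => k _; rewrite conjcM conjcK mulrC.
  by rewrite orth // conjc0 mul0r.
- by rewrite -gsqnorm_inner -expr2 sqr_unit_scale // divff // intr_eq0 gt_eqF.
Qed.

(** Ensures that [undup] in the definition of [QK] does not alter the family, so that [size F] is
    the number of vectors constructed. *)
Lemma orthonormal_uniq (F : seq (seq C)) : Defs.orthonormal F -> uniq F.
Proof.
move=> oF; apply/(uniqP [::]) => i j; rewrite !inE => hi hj e.
apply/eqP; have := oF i j hi hj; rewrite e oF // eqxx.
by case: eqP => // _ /eqP; rewrite oner_eq0.
Qed.

(** The right-hand side is the trace of [A] times the projection onto the span. The normalizing
    square root occurs twice in each term, so only [gsqnorm u] remains. *)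
Lemma sum_braket n (A : 'M[C]_(2 ^ n)) us d : orthogonal_family d us ->
  \sum_(v <- unit_vectors us) braket v A = \sum_i \sum_j A i j * proj_entry R us j i.
Proof.
move=> /andP[/allP hus _]; rewrite big_map.
rewrite (eq_big_seq (fun u => \sum_i \sum_j A i j *
   (gval R (gnth u j) * conjc (gval R (gnth u i)) / (gsqnorm u)%:~R))); last first.
  move=> u /hus/andP[_ s0]; rewrite /braket; apply: eq_bigr => i _; apply: eq_bigr => j _.
  rewrite !gnth_unit -(sqr_unit_scale s0) /unit_val conjc_div_real.
  by have := unit_scale_neq0 s0; move: (_%:C%C) => r r0; field.
rewrite exchange_big; apply: eq_bigr => i _; rewrite exchange_big; apply: eq_bigr => j _.
by rewrite /proj_entry mulr_sumr.
Qed.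

Lemma proj_entry_trace d us : orthogonal_family d us ->
  \sum_(i < d) proj_entry R us i i = (size us)%:R.
Proof.
move=> /andP[/allP hus _]; rewrite /proj_entry exchange_big /=.
rewrite (eq_big_seq (fun=> 1)); first by rewrite big_const_seq count_predT iter_addr_0.
move=> u /hus/andP[/eqP su s0]; rewrite -mulr_suml.
have -> : \sum_(i < d) gval R (gnth u i) * conjc (gval R (gnth u i)) = (gsqnorm u)%:~R.
  by rewrite gsqnorm_inner gval_inner su; apply: eq_bigr => i _; rewrite mulrC.
by rewrite divff // intr_eq0 gt_eqF.
Qed.

End UnitFamily.

Section DensityMatrix.
Variable R : realType.
Local Notation C := R[i].

Lemma sum_delta (I : finType) (F : I -> C) i : \sum_l F l * (l == i)%:R = F i.
Proof.
rewrite (bigD1 i) //= eqxx mulr1 big1 ?addr0 // => l /negbTE->; exact: mulr0.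
Qed.

(** Positivity on the vector [e_i + c e_j]. *)
Lemma psd_pair m (A : 'M[C]_m) i j (c : C) : psd A ->
  0 <= A i i + A i j * c + conjc c * (A j i + A j j * c).
Proof.
move=> /(_ (\col_k ((k == i)%:R + c * (k == j)%:R))).
have e (F : 'I_m -> C) : \sum_l F l * ((l == i)%:R + c * (l == j)%:R) = F i + F j * c.
  under eq_bigr do rewrite mulrDr mulrA.
  by rewrite big_split /= !sum_delta.
have -> : \sum_(k < m) \sum_(l < m) conjc ((\col_k ((k == i)%:R + c * (k == j)%:R)) k 0) * A k l *
      (\col_k ((k == i)%:R + c * (k == j)%:R)) l 0 =
    \sum_(k < m) (A k i + A k j * c) * ((k == i)%:R + conjc c * (k == j)%:R).
  apply: eq_bigr => k _; rewrite -e mulr_suml; apply: eq_bigr => l _.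
  rewrite !mxE rmorphD rmorphM /= !conjc_nat; ring.
under eq_bigr do rewrite mulrDr mulrA.
rewrite big_split /= sum_delta; suff -> : \sum_(k < m) (A k i + A k j * c) * conjc c * (k == j)%:R =
   conjc c * (A j i + A j j * c) by [].
by rewrite (sum_delta (fun k => (A k i + A k j * c) * conjc c)) mulrC.
Qed.

Lemma density_diag m (A : 'M[C]_m) i : density_matrix A -> 0 <= complex.Re (A i i) <= 1.
Proof.
move=> [_ [pA tA]].
have A0 j : 0 <= complex.Re (A j j).
  by have := psd_pair j j 0 pA; rewrite conjc0 mulr0 mul0r !addr0 lecE => /andP[].
rewrite A0 /=; have := congr1 (@complex.Re R) tA; rewrite /mxtrace raddf_sum /= => <-.
by rewrite (bigD1 i) //= lerDl sumr_ge0.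
Qed.

(** Taking [c] to be 1, -1, [i] and [-i] in [psd_pair], with diagonal entries at most 1, bounds the
    real and the imaginary part by 1 each. *)
Lemma density_entry m (A : 'M[C]_m) i j : density_matrix A -> normc (A i j) <= 2.
Proof.
move=> dA; have [hA [pA _]] := dA.
have /andP[_ hi] := density_diag i dA; have /andP[_ hj] := density_diag j dA.
have Aji : A j i = conjc (A i j) by apply: hA.
have h c : 0 <= A i i + A i j * c + conjc c * (A j i + A j j * c) by apply: psd_pair.
apply: le_trans (normc_le_add _) _.
have := h (Complex 1 0); have := h (Complex (-1) 0); have := h (Complex 0 1); have := h (Complex 0 (-1)).
rewrite !lecE Aji; case: (A i j) (A i i) (A j j) hi hj => a b [u u'] [v v'] /= hi hj.
move=> /andP[_ h1] /andP[_ h2] /andP[_ h3] /andP[_ h4].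
have : `|a| <= 1 by rewrite ler_norml; lra.
have : `|b| <= 1 by rewrite ler_norml; lra.
by lra.
Qed.

End DensityMatrix.

(** * Effective approximation and the theorem *)

Lemma comp_proj_test (A : countType) (x0 : nat) (x1 : A -> nat) (x2 : A -> seq (seq ecode))
    (x3 : A -> seq (seq gint)) (x4 : A -> nat) :
  computable x1 -> computable x2 -> computable x3 -> computable x4 ->
  computable (fun a => proj_test x0 (x1 a) (x2 a) (x3 a) (x4 a)).
Proof.
move=> h1 h2 h3 h4; suff H : computable (fun p : nat * seq (seq ecode) *
    seq (seq gint) * nat => proj_test x0 p.1.1.1 p.1.1.2 p.1.2 p.2).
  exact: (comp_ap H (comp_pair (comp_pair (comp_pair h1 h2) h3) h4)).
by rewrite /proj_test; comp_tac; apply: comp_entry_test; comp_tac.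
Qed.

Section Approximation.
Variable R : realType.
Local Notation C := R[i].

Lemma proj_test_complete k n d (S : 'M[C]_(2 ^ n)) : special_projection S -> mx_denotes d S ->
  exists us N, proj_test k n d us N.
Proof.
move=> [hS [S2 _]] [_ hd]; pose T := (2 ^ (2 * n + k))%N.
have T0 : (0 < T)%N by rewrite expn_gt0.
have e0 : 0 < (4 * T)%:R^-1 :> R by rewrite invr_gt0 ltr0n muln_gt0.
have [us [ous hus]] := projection_dense hS S2 e0.
have pus : all (fun u => 0 < gsqnorm u) us.
  by apply/allP => u uus; have /andP[/allP/(_ u uus)/andP[]] := ous.
have /choice[N hN] : forall p : 'I_(2 ^ n) * 'I_(2 ^ n), exists N0, forall N, (N0 <= N)%N ->
    entry_test (nth entry0 (nth [::] d p.1) p.2) (proj_frac us p.1 p.2) T N.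
  move=> [i j] /=; have [P0 eP] := proj_fracE R i j pus; have [_ he] := hd i j.
  apply: (entry_test_complete he T0 P0); rewrite eP mulrC mulKf ?intr_eq0 ?gt_eqF //.
exists us, (\max_p N p); rewrite /proj_test ous andTb.
apply/allP => i; rewrite mem_iota add0n => /andP[_ hi].
apply/allP => j; rewrite mem_iota add0n => /andP[_ hj].
by apply: (hN (Ordinal hi, Ordinal hj)); apply: leq_bigmax.
Qed.

Lemma proj_test_sound k n d (S : 'M[C]_(2 ^ n)) us N : mx_denotes d S -> proj_test k n d us N ->
  orthogonal_family (2 ^ n) us /\
  forall i j : 'I_(2 ^ n), normc (S i j - proj_entry R us i j) <= (2 ^ (2 * n + k))%:R^-1.
Proof.
move=> [_ hd] /andP[ous /allP h]; split=> // i j.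
have T0 : (0 < 2 ^ (2 * n + k))%N by rewrite expn_gt0.
have pus : all (fun u => 0 < gsqnorm u) us.
  by apply/allP => u uus; have /andP[/allP/(_ u uus)/andP[]] := ous.
have inI (a : 'I_(2 ^ n)) : val a \in iota 0 (2 ^ n) by rewrite mem_iota /= add0n.
have /allP/(_ _ (inI j)) ht := h _ (inI i).
have [P0 eP] := proj_fracE R i j pus; have [_ he] := hd i j.
by have := entry_test_sound he T0 P0 ht; rewrite eP mulrC mulKf ?intr_eq0 ?gt_eqF.
Qed.

(** The least code of a pair (family, grid resolution) that passes the test is found by unbounded
    search; completeness makes the search stop and soundness gives the precision. *)
Lemma computable_approx k (dim : nat -> nat) (S : forall m, 'M[C]_(2 ^ dim m)) :
  computable_proj_seq S -> (forall m, special_projection (S m)) ->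
  exists V : nat -> nat * seq (seq gint), computable V /\ forall m,
    [/\ (V m).1 = dim m, orthogonal_family (2 ^ dim m) (V m).2 &
      forall i j : 'I_(2 ^ dim m),
        normc (S m i j - proj_entry R (V m).2 i j) <= (2 ^ (2 * dim m + k))%:R^-1].
Proof.
move=> [g [[p hp] hg]] sS.
have cg : computable g by exists g => //; exists p => -[|x [|y v]].
(* A number that does not decode to a pair counts as failing the test. *)
pose chk m w := oapp (fun nd : nat * seq (seq ecode) =>
  oapp (fun c : seq (seq gint) * nat => proj_test k nd.1 nd.2 c.1 c.2) false (unpickle w))
  false (unpickle (g m)).
have hex m : exists w, chk m w.
  have [d [ed hd]] := hg m; have [us [N hN]] := proj_test_complete k (sS m) hd.
  by exists (pickle (us, N)); rewrite /chk ed /= pickleK.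
have ucode : comp_unpickle (nat * seq (seq ecode))%type.
  apply: comp_unpickle_pair comp_unpickle_nat _; do 2 apply: comp_unpickle_seq.
  apply: comp_unpickle_pair; first exact: comp_unpickle_seq comp_unpickle_int.
  by do 3 (apply: comp_unpickle_pair; last exact: comp_unpickle_rat); apply: comp_unpickle_rat.
have uus : comp_unpickle (seq (seq gint) * nat)%type.
  apply: comp_unpickle_pair comp_unpickle_nat; do 2 apply: comp_unpickle_seq.
  by apply: comp_unpickle_pair; apply: comp_unpickle_int.
pose wit m := ex_minn (hex m).
have cwit : computable wit.
  apply: (comp_search (P := chk)).
    rewrite /chk; comp_tac; last by apply: (comp_ap cg); comp_tac.
    by apply: comp_proj_test; comp_tac.
  move=> m; rewrite /wit; case: ex_minnP => w hw mw; split=> // i.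
  by apply: contraTN => /mw; rewrite -leqNgt.
exists (fun m => (oapp fst 0%N (unpickle (g m) : option (nat * seq (seq ecode))),
  oapp fst [::] (unpickle (wit m) : option (seq (seq gint) * nat)))); split.
  by comp_tac.
move=> m; have [d [ed hd]] := hg m.
have : chk m (wit m) by rewrite /wit; case: ex_minnP.
rewrite /chk ed /=; case: unpickle => [[us N]|//] /= ht.
by have [h1 h2] := proj_test_sound hd ht; split.
Qed.

(** The approximating projection has trace [size us], and only the [2^n] diagonal entries contribute
    to the error. *)
Lemma approx_trace n (S : 'M[C]_(2 ^ n)) us (t : R) : orthogonal_family (2 ^ n) us ->
  (forall i j : 'I_(2 ^ n), normc (S i j - proj_entry R us i j) <= t) ->
  `|complex.Re (\tr S) - (size us)%:R| <= (2 ^ n)%:R * t.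
Proof.
move=> ous h; have -> : complex.Re (\tr S) - (size us)%:R = complex.Re (\tr S - (size us)%:R).
  by rewrite raddfB /= -(rmorph_nat (real_complex R)).
apply: le_trans (normc_ReB _) _; rewrite -(proj_entry_trace R ous) /mxtrace -sumrB.
apply: le_trans (normc_sum _ _ _) _; apply: le_trans (ler_sum _ (fun i _ => h i i)) _.
by rewrite sumr_const card_ord mulr_natl.
Qed.

(** Each of the [4^n] products in the trace is off by at most [2 t], the entries of [rho] being
    bounded by 2. *)
Lemma approx_weight n (S rho : 'M[C]_(2 ^ n)) us (t eps : R) : orthogonal_family (2 ^ n) us ->
  (forall i j : 'I_(2 ^ n), normc (S i j - proj_entry R us i j) <= t) ->
  density_matrix rho -> Complex eps 0 < \tr (rho *m S) ->
  Complex (eps - (2 ^ n)%:R ^+ 2 * (2 * t)) 0 < \sum_(v <- unit_vectors R us) braket v rho.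
Proof.
move=> ous h drho heps.
(* The order on complex numbers compares only numbers with equal imaginary parts; positivity shows
   that this sum is real. *)
have s0 : 0 <= \sum_(v <- unit_vectors R us) braket v rho.
  apply: sumr_ge0 => v _; have [_ [/(_ (\col_i nth 0 v i)) + _]] := drho.
  by rewrite /braket; under eq_bigr do under eq_bigr do rewrite !mxE.
have hd : normc (\tr (rho *m S) - \sum_(v <- unit_vectors R us) braket v rho) <= (2 ^ n)%:R ^+ 2 * (2 * t).
  have -> : \tr (rho *m S) = \sum_i \sum_j rho i j * S j i by apply: eq_bigr => i _; rewrite mxE.
  rewrite (sum_braket rho ous) -sumrB; apply: le_trans (normc_sum _ _ _) _.
  have cs (c : R) : (2 ^ n)%:R * c = \sum_(i < 2 ^ n) c by rewrite sumr_const card_ord mulr_natl.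
  rewrite expr2 -mulrA cs.
  apply: ler_sum => i _; rewrite -sumrB; apply: le_trans (normc_sum _ _ _) _.
  rewrite cs; apply: ler_sum => j _.
  rewrite -mulrBr ComplexField.Normc.normcM.
  by apply: ler_pM; rewrite ?normc_ge0 ?density_entry.
have := le_trans (normc_ReB _) hd; rewrite raddfB /= ler_norml => /andP[_ h2].
move: heps; rewrite !ltcE /= => /andP[_ h1]; apply/andP; split; last by lra.
by move: s0; rewrite lecE /= => /andP[].
Qed.

End Approximation.

(** * Complexity bounds and counting in a level *)

Section Levels.
Variable R : realType.

(** The normalized family is itself admissible in the infimum, and [hl] bounds the logarithm of its
    size by [n - l]. *)
Lemma QK_le (U : machine) (eps : R) n (rho : 'M[R[i]]_(2 ^ n)) us sigma l :
  U sigma = Some (pickle (unit_family us)) -> orthogonal_family (2 ^ n) us ->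
  Complex eps 0 < \sum_(v <- unit_vectors R us) braket v rho ->
  (0 < size us)%N -> (size us * 2 ^ l <= 2 ^ n)%N ->
  (QK U eps rho <= ((size sigma)%:R + (n%:R - l%:R))%:E)%E.
Proof.
move=> hU ous hw us0 hl; have oF := unit_vectors_orthonormal (R := R) ous.
apply: (@le_trans _ _ ((size sigma)%:R + log2 (size us)%:R)%:E).
  apply: ereal_inf_lbound; exists sigma, (pickle (unit_family us)), (unit_vectors R us).
  split=> //; split; first exact: unit_family_codes ous.
  rewrite /= (undup_id (orthonormal_uniq oF)) size_map; do !split=> //.
  move=> v /mapP[u uus ->]; rewrite size_map.
  by have /andP[/allP/(_ u uus)/andP[/eqP]] := ous.
rewrite lee_fin lerD2l /log2; have ln2 : 0 < ln 2 :> R by rewrite ln_gt0 // ltr1n.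
have p2 (j : nat) : (2 ^ j)%:R \is @Num.pos R by rewrite posrE ltr0n expn_gt0.
rewrite ler_pdivrMr // mulrBl lerBrDr !mulr_natl -!lnXn // -!natrX -lnM ?posrE ?ltr0n ?expn_gt0 //.
by rewrite -natrM ler_ln ?posrE ?ltr0n ?muln_gt0 ?us0 ?expn_gt0 // ler_nat.
Qed.

(** The exponent [s ((a + 2) q + 1)] is at most [a q + 1], by the choice of [a] and [s <= 1]. *)
Lemma powR_level (s tau : R) (a q : nat) : 0 <= s <= 1 -> s * a.+2%:R <= a%:R ->
  (2 ^+ (a.+2 * q + 1))^-1 <= tau -> (2 ^+ (a * q + 1))^-1 <= tau `^ s.
Proof.
move=> /andP[s0 s1] hs ht.
have e2 (j : nat) : (2 ^+ j)^-1 = 2 `^ (- j%:R) :> R by rewrite powRN powR_mulrn.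
have t0 : 0 <= (2 ^+ (a.+2 * q + 1))^-1 :> R by rewrite invr_ge0 exprn_ge0.
apply: le_trans (ge0_ler_powR s0 _ _ ht); rewrite ?nnegrE ?(le_trans t0) //.
rewrite !e2 -powRrM; apply: ler_powR; first by rewrite ler1n.
rewrite mulNr lerN2 !natrD !natrM.
by have := ler_wpM2r (ler0n R q) hs; lra.
Qed.

(** Markov's inequality for the counting measure. *)
Lemma count_le_sum (P : nat -> bool) (f : nat -> R) w m : (forall i, 0 <= f i) ->
  (forall i, P i -> w <= f i) -> (count P (iota 0 m))%:R * w <= \sum_(0 <= i < m) f i.
Proof.
move=> f0 h; elim: m => [|m IH]; first by rewrite big_geq // mul0r.
rewrite big_nat_recr // -{1}addn1 iotaD count_cat natrD mulrDl; apply: lerD => //.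
rewrite add0n /= addn0; case E: (P m); first by rewrite mul1r h.
by rewrite mul0r.
Qed.

End Levels.

Theorem mainTheorem12 (R : realType) (U : machine) (rho : forall n, 'M[R[i]]_(2 ^ n)) :
  universal_pf U ->
  is_state rho ->
  (forall eps : R, 0 < eps ->
     exists c : R, forall n : nat, ((n%:R - c)%:E < QK U eps (rho n))%E) ->
  forall s : rat, 0 < s < 1 ->
  forall (dim : nat -> nat) (S : forall m, 'M[R[i]]_(2 ^ dim m)),
    s_strong_solovay_test s S -> passes rho S.
Proof.
move=> [_ univ] [drho _] hQK s /andP[s0 s1] dim S [[cS [sS sumT]] [sumTs _]] eps eps0 fails.
(* The other half of [eps] pays for replacing [S m] by its approximation. *)
have [c hc] := hQK (eps / 2) ltac:(by rewrite divr_gt0).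
(* The weight lost is at most [4^n * 2 * 2^-(2 n + k) = 2 / 2^k], which has to stay below
   [eps / 2]. *)
pose k := (Num.truncn (4 / eps)).+1.
have hk : 4 <= eps * (2 ^ k)%:R.
  rewrite mulrC -ler_pdivrMr //; apply/ltW/(lt_le_trans (Num.Theory.truncnS_gt _)).
  by rewrite ler_nat ltnW // ltn_expl.
have [V [cV hV]] := computable_approx k cS sS.
pose r m := size (V m).2.
have rT m : `|complex.Re (\tr (S m)) - (r m)%:R| <= 1 / 2.
  have [_ ous h] := hV m; apply: le_trans (approx_trace ous h) _.
  have -> : (2 * dim m + k = dim m + (dim m + k))%N by lia.
  rewrite expnD natrM invfM mulrA divff ?pnatr_eq0 ?expn_eq0 // mul1r div1r.
  rewrite lef_pV2 ?posrE ?ltr0n ?expn_gt0 // ler_nat.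
  by rewrite /k addnS expnS leq_pmulr // expn_gt0.
(* From [Tr >= r - 1 / 2] and [r >= 1] one gets [Tr >= r / 2]. *)
have rtau m : (0 < r m)%N -> (r m)%:R <= 2 * tauS (S m) * (2 ^ dim m)%:R.
  move=> r0; rewrite /tauS -mulrA divfK ?pnatr_eq0 ?expn_eq0 //.
  have := rT m; rewrite ler_norml => /andP[h _].
  have : 1 <= (r m)%:R :> R by rewrite ler1n.
  by lra.
(* The inequality amounts to [a (1 - s) >= 2 s]. *)
have [a ha] : exists a : nat, ratr s * a.+2%:R <= a%:R :> R.
  have s1' : 0 < 1 - ratr s :> R by rewrite subr_gt0 -(rmorph1 ratr) ltr_rat.
  have := Num.Theory.truncnS_gt (2 * ratr s / (1 - ratr s) : R).
  rewrite ltr_pdivrMr //; move: (Num.truncn _) => n h; exists n.+1.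
  by rewrite -(addn2 n.+1) natrD; move: h; move: (n.+1%:R) => x; lra.
(* For nonzero [r m], [q] is the integer part of [log2 (2^n / r m) / (a + 2)], where [n] is the
   dimension of [S m]. *)
pose lev q m := [&& (0 < r m)%N, (r m * 2 ^ (a.+2 * q) <= 2 ^ (V m).1)%N &
  (2 ^ (V m).1 < r m * 2 ^ (a.+2 * q.+1))%N].
have clev : computable (fun p : nat * nat => lev p.1 p.2).
  have cV2 : computable (fun p : nat * nat => V p.2) by apply: (comp_ap cV); comp_tac.
  by rewrite /lev /r; comp_tac.
have cout : computable (fun m => unit_family (V m).2) by comp_tac.
(* The upper bound in [lev] has exponent [(a + 2) (q + 1)], and the factor 2 of [rtau] accounts for
   the extra 1. *)
have levtau q m : lev q m -> (2 ^+ (a * q.+1 + 1))^-1 <= tauS (S m) `^ ratr s.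
  move=> /and3P[r0 _ h]; apply: powR_level => //.
    by rewrite -(rmorph0 ratr) -(rmorph1 ratr) !ler_rat !ltW.
  have [e _ _] := hV m; rewrite e in h; rewrite -natrX -[_^-1]mul1r ler_pdivrMr ?ltr0n ?expn_gt0 //.
  rewrite addn1 expnS natrM mulrCA mulrA; move: h; rewrite -(ltr_nat R) natrM => h.
  have p0 : 0 < (2 ^ dim m)%:R :> R by rewrite ltr0n expn_gt0.
  have e0 : 0 < (2 ^ (a.+2 * q.+1))%:R :> R by rewrite ltr0n expn_gt0.
  have := rtau m r0; move: h p0 e0; move: (_%:R) (_%:R) (_%:R) (tauS _) => x y z u.
  move=> h p0 e0 hr; rewrite -(ler_pM2l p0) mulr1; apply: ltW; apply: lt_le_trans h _.
  by rewrite mulrA ler_pM2r // mulrC.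
have [b b0 hb] : exists2 b, (0 < b)%N & forall q m, (count (lev q) (iota 0 m) < 2 ^ (a * q + b))%N.
  pose B := limn (series (fun m => tauS (S m) `^ ratr s)).
  have hB m : \sum_(0 <= i < m) tauS (S i) `^ ratr s <= B.
    apply: (nondecreasing_cvgn_le (u_ := series _)) => //.
    by apply: nondecreasing_series => i _ _; apply: powR_ge0.
  (* Every member of level [q] contributes at least [2^-(a (q + 1) + 1)] to a sum bounded by [B], so
     there are at most [B 2^(a + 1) 2^(a q)] of them; finally [B 2^(a + 1) < b <= 2^b]. *)
  exists (Num.truncn (B * (2 ^ (a + 1))%:R)).+1 => // q m; rewrite -(ltr_nat R).
  have := count_le_sum m (fun i => powR_ge0 (tauS (S i)) (ratr s)) (levtau q).
  rewrite -ler_pdivlMr ?invr_gt0 ?exprn_gt0 // invrK => h; apply: le_lt_trans h _.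
  apply: le_lt_trans (_ : B * (2 ^+ (a * q.+1 + 1)) < _); first by rewrite ler_wpM2r ?exprn_ge0.
  have -> : (a * q.+1 + 1 = (a + 1) + a * q)%N by rewrite mulnS; lia.
  rewrite exprD mulrA [X in _ < X]natrX [in X in _ < X]addnC [X in _ < X]exprD ltr_pM2r ?exprn_gt0 // -natrX.
  apply: lt_le_trans (Num.Theory.truncnS_gt _) _.
  by rewrite -natrX ler_nat ltnW // ltn_expl.
have [M pfM hM] := prefix_machine a b0 clev cout.
have [tau htau] := univ M pfM.
(* [Q] exceeds the constant overhead of a description: the prefix [tau] that selects [M], the
   separating 0 and the [b] bits, together with the constant [c]. *)
pose Q := (Num.truncn (c + (size tau)%:R + b%:R + 1)).+1.
have [m [r0 hrho hq]] : exists m, [/\ (0 < r m)%N, Complex (eps / 2) 0 <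
      \sum_(v <- unit_vectors R (V m).2) braket v (rho (dim m)) &
      (r m * 2 ^ (a.+2 * Q) <= 2 ^ dim m)%N].
  (* The terms of a convergent series tend to 0; the additional factor 2 in the threshold absorbs
     the one in [rtau]. *)
  have /cvgrPdist_lt/(_ (2 ^+ (a.+2 * Q).+1)^-1) := cvg_series_cvg_0 sumT.
  rewrite invr_gt0 exprn_gt0 // => /(_ isT) [N _ hN].
  have [m [Nm hm]] := fails N; exists m; have [e ous h] := hV m.
  have hw : Complex (eps / 2) 0 < \sum_(v <- unit_vectors R (V m).2) braket v (rho (dim m)).
    have := approx_weight ous h (drho _) hm; apply: le_lt_trans; rewrite lecE /= eqxx /=.
    have -> : (2 ^ dim m)%:R ^+ 2 * (2 * (2 ^ (2 * dim m + k))%:R^-1) = 2 / (2 ^ k)%:R :> R.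
      rewrite expnD natrM mul2n -addnn expnD natrM.
      by field; rewrite !pnatr_eq0 !expn_eq0.
    have : 2 / (2 ^ k)%:R <= eps / 2 by rewrite ler_pdivrMr ?ltr0n ?expn_gt0 //; lra.
    by lra.
  (* An empty family has weight 0, which is not above [eps / 2]. *)
  have r0 : (0 < r m)%N.
    rewrite lt0n; apply: contraTneq hw => /size0nil ->; rewrite big_nil ltcE /= eqxx /=.
    by rewrite -leNgt; lra.
  split=> //; rewrite -(ler_nat R) natrM [X in _ * X <= _]natrX.
  have := hN m Nm; rewrite /= sub0r normrN => /(le_lt_trans (ler_norm _)) ht.
  have p0 : 0 < (2 ^ dim m)%:R :> R by rewrite ltr0n expn_gt0.
  have e0 : 0 < 2 ^+ (a.+2 * Q) :> R by rewrite exprn_gt0.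
  move: ht; rewrite exprS -[_^-1]mul1r ltr_pdivlMr ?mulr_gt0 // => ht.
  apply: le_trans (ler_wpM2r (ltW e0) (rtau m r0)) _.
  rewrite mulrAC -[X in _ <= X]mul1r; apply: ler_wpM2r; first exact: ltW.
  by apply: ltW; move: ht; rewrite mulrA (mulrC _ 2).
have [e ous h] := hV m.
(* The level of [m] is the largest exponent satisfying the lower condition. It may exceed [Q], which
   only shortens the description relative to [n]. *)
have [q Qq hlev] : exists2 q, (Q <= q)%N & lev q m.
  have bnd j : (r m * 2 ^ (a.+2 * j) <= 2 ^ dim m)%N -> (j <= dim m)%N.
    move=> hj; rewrite -(leq_exp2l (m := 2)) //; apply: leq_trans hj.
    apply: leq_trans (leq_pmull _ r0); rewrite leq_exp2l //; exact: leq_pmull.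
  have ex : exists j, (r m * 2 ^ (a.+2 * j) <= 2 ^ dim m)%N by exists Q.
  case: (ex_maxnP ex bnd) => q hq' mq; exists q; first exact: mq.
  by rewrite /lev r0 e hq' ltnNge; apply/negP => /mq; rewrite ltnn.
have [sigma ssz Ms] := hM q m hlev (hb q m).
have /and3P[_ hq' _] := hlev; rewrite e in hq'.
have hU : U (tau ++ sigma) = Some (pickle (unit_family (V m).2)) by rewrite htau.
(* The two bounds on [QK] give [n - c < n - q + size tau + b + 1], against [q >= Q]. *)
have := lt_le_trans (hc (dim m)) (QK_le hU ous hrho r0 hq'); rewrite lte_fin size_cat ssz.
have -> : (size tau + (q.+1 + (a * q + b)))%N%:R = (size tau)%:R + (q%:R + 1 + ((a * q)%:R + b%:R)) :> R.
  by rewrite !natrD -natr1.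
have -> : (a.+2 * q)%:R = (a * q)%:R + 2 * q%:R :> R by rewrite -natrM -natrD; congr _%:R; lia.
have : c + (size tau)%:R + b%:R + 1 < q%:R.
  by apply: lt_le_trans (Num.Theory.truncnS_gt _) _; rewrite ler_nat.
by lra.
Qed.
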